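(* Let $q \geq 2$ be an integer and let $\mathbb{HP}^q$ be the quaternionic projective space of real dimension $4q$, equipped with its standard Riemannian metric $g$. Then $(\mathbb{HP}^q, g)$ admits no local orthogonal coordinates; that is, there is no non-empty open subset $\mathcal{U} \subset \mathbb{HP}^q$ carrying a system of orthogonal coordinates for $g$.
   Context: Let $(M,g)$ be a Riemannian manifold of dimension $n$. A system of (real, smooth) local coordinates $x_1, \ldots, x_n$ defined on an open set $\mathcal{U} \subset M$ is called orthogonal if $g\left(\frac{\partial}{\partial x_i}, \frac{\partial}{\partial x_j}\right) = 0$ on $\mathcal{U}$ whenever $i \neq j$, i.e. if on $\mathcal{U}$ the metric has the form $g = \sum_{j=1}^n a_j^2\, dx_j \otimes dx_j$ for some positive functions $a_1, \ldots, a_n$ on $\mathcal{U}$. The standard metric $g$ on $\mathbb{HP}^q$ is, up to a positive constant factor, the metric making the quaternionic Hopf fibration $\mathbb{S}^{4q+3} \to \mathbb{HP}^q$ from the round unit sphere a Riemannian submersion. It is part of the standard quaternionic Kähler structure: there is a rank $3$ subbundle $Q$ of the bundle of skew-symmetric endomorphisms of $T\mathbb{HP}^q$, preserved by the Levi-Civita connection of $g$ and locally generated by triplets of almost complex structures $J_1, J_2, J_3$ with $J_1J_2J_3 = -\mathrm{Id}$. Setting $\omega_\alpha := g(J_\alpha \cdot, \cdot)$ for $\alpha = 1,2,3$, and denoting by $\omega_\alpha^{\sharp_g}$ the section of $\Lambda^2 T\mathbb{HP}^q$ dual to $\omega_\alpha$ via $g$, the curvature, viewed as a symmetric endomorphism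 of $\Lambda^2 T\mathbb{HP}^q$, is, up to scaling, locally given by $$\mathrm{R}(X \wedge Y) = X \wedge Y + \sum_{\alpha=1}^3 J_\alpha X \wedge J_\alpha Y + 2\sum_{\alpha=1}^3 \omega_\alpha(X,Y)\, \omega_\alpha^{\sharp_g}.$$ *)

(* Defs.v *)
From HB Require Import structures.
From mathcomp Require Import all_boot all_order all_algebra.
From mathcomp Require Import all_classical all_reals all_analysis.
From mathcomp Require Import ring.

Set Implicit Arguments.
Unset Strict Implicit.
Unset Printing Implicit Defensive.

Import Order.TTheory GRing.Theory Num.Theory.
Import numFieldNormedType.Exports.

Local Open Scope classical_set_scope.
Local Open Scope quotient_scope.
Local Open Scope ring_scope.

(* [Ck k A f] is meant for an open set [A]: then neither [differentiable f x]
   nor ['D_v f x] for [x] in [A] depends on the values of [f] outside [A]. *)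
Fixpoint Ck (R : realType) (V W : normedModType R) (k : nat)
    (A : set V) (f : V -> W) : Prop :=
  if k is k'.+1 then
    (forall x, A x -> differentiable f x) /\ (forall v, Ck k' A ('D_v f))
  else forall x, A x -> {for x, continuous f}.

Definition Cinfty (R : realType) (V W : normedModType R)
    (A : set V) (f : V -> W) : Prop :=
  forall k, Ck k A f.

(* [chart_map] is only meaningful on [chart_dom], and [chart_inv], its inverse,
   only on [chart_map @` chart_dom]. *)
Record coord_system (R : realType) (M : topologicalType) (n : nat) :=
  CoordSystem {
    chart_dom : set M;
    chart_map : M -> 'rV[R]_n;
    chart_inv : 'rV[R]_n -> M
  }.

Definition is_chart (R : realType) (M : topologicalType) (n : nat)
    (c : coord_system R M n) : Prop :=
  [/\ open (chart_dom c),
      open (chart_map c @` chart_dom c),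
      {in chart_dom c, cancel (chart_map c) (chart_inv c)},
      {within chart_dom c, continuous (chart_map c)} &
      {within chart_map c @` chart_dom c, continuous (chart_inv c)}].

Definition compatible (R : realType) (M : topologicalType) (n : nat)
    (c c' : coord_system R M n) : Prop :=
  Cinfty (chart_map c @` (chart_dom c `&` chart_dom c'))
         (chart_map c' \o chart_inv c) /\
  Cinfty (chart_map c' @` (chart_dom c `&` chart_dom c'))
         (chart_map c \o chart_inv c').

(* Membership in the maximal smooth atlas generated by [atlas]. *)
Definition smooth_coordinates (R : realType) (M : topologicalType) (n : nat)
    (atlas : set (coord_system R M n)) (c : coord_system R M n) : Prop :=
  is_chart c /\ forall a, atlas a -> compatible c a.

Section Quaternions.
Variable R : realType.

(* The quaternion x0 + x1 i + x2 j + x3 k is the column (x0, x1, x2, x3). *)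
Local Notation quat := 'cV[R]_4.

Definition qc (a : quat) (k : nat) : R := a (inord k) 0.

Definition quat_of (s : seq R) : quat := \col_k s`_k.

Definition qone : quat := quat_of [:: 1; 0; 0; 0].

Definition qmul (a b : quat) : quat := quat_of
  [:: qc a 0 * qc b 0 - qc a 1 * qc b 1 - qc a 2 * qc b 2 - qc a 3 * qc b 3;
      qc a 0 * qc b 1 + qc a 1 * qc b 0 + qc a 2 * qc b 3 - qc a 3 * qc b 2;
      qc a 0 * qc b 2 - qc a 1 * qc b 3 + qc a 2 * qc b 0 + qc a 3 * qc b 1;
      qc a 0 * qc b 3 + qc a 1 * qc b 2 - qc a 2 * qc b 1 + qc a 3 * qc b 0].

Definition qconj (a : quat) : quat :=
  quat_of [:: qc a 0; - qc a 1; - qc a 2; - qc a 3].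

(* The column j of [v : 'M[R]_(4, m)] is the j-th quaternionic coordinate of a
   vector of H^m = R^(4m); [dot] is the Euclidean inner product of R^(4m). *)
Definition dot m (v w : 'M[R]_(4, m)) : R := \sum_i \sum_j v i j * w i j.

Definition qinv (a : quat) : quat := (dot a a)^-1 *: qconj a.

Definition hscale m (v : 'M[R]_(4, m)) (l : quat) : 'M[R]_(4, m) :=
  \matrix_(i, j) qmul (col j v) l i 0.

Lemma qcE s k : (k < 4)%N -> qc (quat_of s) k = s`_k.
Proof. by move=> k4; rewrite /qc mxE inordK. Qed.

Lemma qcZ x (a : quat) k : qc (x *: a) k = x * qc a k.
Proof. by rewrite /qc mxE. Qed.

Lemma qcP (a b : quat) : (forall k, (k < 4)%N -> qc a k = qc b k) -> a = b.
Proof.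
move=> ab; apply/matrixP => i j; rewrite (ord1 j).
by have := ab _ (ltn_ord i); rewrite /qc inord_val.
Qed.

Lemma dotqE (a b : quat) : dot a b =
  qc a 0 * qc b 0 + qc a 1 * qc b 1 + qc a 2 * qc b 2 + qc a 3 * qc b 3.
Proof.
rewrite /dot (eq_bigr (fun i : 'I_4 => qc a i * qc b i)); last first.
  by move=> i _; rewrite big_ord1 /qc inord_val.
by rewrite !big_ord_recr big_ord0 /= add0r.
Qed.

Lemma qmulA : associative qmul.
Proof.
move=> a b c; apply: qcP; case=> [|[|[|[|//]]]] _;
  rewrite !qcE //= ?qcE //=; ring.
Qed.

Lemma qmulq1 a : qmul a qone = a.
Proof. by apply: qcP; case=> [|[|[|[|//]]]] _; rewrite !qcE //= ?qcE //=; ring. Qed.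

Lemma qmul_conj a : qmul a (qconj a) = dot a a *: qone.
Proof.
apply: qcP; case=> [|[|[|[|//]]]] _;
  rewrite qcZ dotqE !qcE //= ?qcE //=; ring.
Qed.

Lemma dot_qmul a b : dot (qmul a b) (qmul a b) = dot a a * dot b b.
Proof. rewrite !dotqE !qcE //=; ring. Qed.

Lemma dot_qconj a : dot (qconj a) (qconj a) = dot a a.
Proof. rewrite !dotqE !qcE //=; ring. Qed.

Lemma hscale1 m (v : 'M[R]_(4, m)) : hscale v qone = v.
Proof. by apply/matrixP => i j; rewrite mxE qmulq1 mxE. Qed.

Lemma hscaleA m (v : 'M[R]_(4, m)) a b :
  hscale (hscale v a) b = hscale v (qmul a b).
Proof.
apply/matrixP => i j; rewrite [LHS]mxE [RHS]mxE qmulA; congr (qmul _ b i 0).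
by apply/matrixP => k l; rewrite (ord1 l) [LHS]mxE [LHS]mxE.
Qed.

Lemma dot_qone : dot qone qone = 1.
Proof. rewrite dotqE !qcE //=; ring. Qed.

End Quaternions.

Section QuaternionicProjectiveSpace.
Variables (R : realType) (q : nat).

Definition sphere : set 'M[R]_(4, q.+1) := [set v | dot v v = 1].

(* Orbits of the right action of Sp(1), the group of unit quaternions. *)
Definition hopf_rel (u v : sphere) : bool :=
  `[< exists l : 'cV[R]_4, dot l l = 1 /\ \val v = hscale (\val u) l >].

Lemma hopf_rel_refl : reflexive hopf_rel.
Proof.
by move=> u; apply/asboolP; exists (qone R); rewrite dot_qone hscale1.
Qed.

Lemma hopf_rel_sym : symmetric hopf_rel.
Proof.
suff H u v : hopf_rel u v -> hopf_rel v u by move=> u v; apply/idP/idP; apply: H.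
move=> /asboolP[l [l1 vE]]; apply/asboolP; exists (qconj l).
by rewrite dot_qconj l1 vE hscaleA qmul_conj l1 scale1r hscale1.
Qed.

Lemma hopf_rel_trans : transitive hopf_rel.
Proof.
move=> v u w /asboolP[a [a1 vE]] /asboolP[b [b1 wE]]; apply/asboolP.
by exists (qmul a b); rewrite dot_qmul a1 b1 mulr1 wE vE hscaleA.
Qed.

Definition hopf_equiv : equiv_rel sphere :=
  EquivRel hopf_rel hopf_rel_refl hopf_rel_sym hopf_rel_trans.

Definition HP := quotient_topology {eq_quot hopf_equiv}.

HB.instance Definition _ := Topological.on HP.
HB.instance Definition _ := Quotient.on HP.

Lemma hopf_base_subproof : delta_mx 0 0 \in sphere.
Proof.
rewrite inE /sphere /= /dot (bigD1 0) //= (bigD1 0) //= !mxE !eqxx mulr1.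
rewrite !big1 ?addr0 // => [i /negbTE i0|i /negbTE i0].
  by apply: big1 => j _; rewrite !mxE i0 mulr0.
by rewrite !mxE i0 andbF mulr0.
Qed.

Definition hopf_base : sphere :=
  exist (fun v => v \in sphere) _ hopf_base_subproof.

(* The Hopf fibration precomposed with the radial retraction v |-> v / |v| of
   H^(q+1) \ {0} onto the sphere; its value at 0 is irrelevant. *)
Definition hopf (v : 'M[R]_(4, q.+1)) : HP :=
  \pi_HP (insubd hopf_base ((Num.sqrt (dot v v))^-1 *: v)).

(* The affine chart [z_0 : ... : z_q] |-> (z_j z_k^-1)_(j != k) on z_k != 0,
   with values in H^q = R^(4q). *)
Definition affine_coord (k : 'I_q.+1) (p : HP) : 'rV[R]_(4 * q) :=
  let z := \val (repr p) in mxvec (hscale (col' k z) (qinv (col k z))).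

Definition affine_param (k : 'I_q.+1) (y : 'rV[R]_(4 * q)) : HP :=
  hopf (\matrix_(i, j) if unlift k j is Some j' then vec_mx y i j'
                       else qone R i 0).

Definition affine_chart (k : 'I_q.+1) : coord_system R HP (4 * q) :=
  CoordSystem [set p : HP | col k (\val (repr p)) != 0]
              (affine_coord k) (affine_param k).

Definition HP_coordinates (c : coord_system R HP (4 * q)) : Prop :=
  smooth_coordinates (range affine_chart) c.

(* [w] is tangent to the sphere at [z], and orthogonal to the tangent space
   z.Im(H) of the fibre z.Sp(1) of the Hopf fibration. *)
Definition horizontal (z w : 'M[R]_(4, q.+1)) : Prop :=
  dot z w = 0 /\
  forall l : 'cV[R]_4, qc l 0 = 0 -> dot (hscale z l) w = 0.

(* The horizontal lift to [z] of the tangent vector at [hopf z] whose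
   components in the coordinates [c] are [xi]. *)
Definition hlift (c : coord_system R HP (4 * q)) (z : 'M[R]_(4, q.+1))
    (xi : 'rV[R]_(4 * q)) : 'M[R]_(4, q.+1) :=
  xget 0 [set w | horizontal z w /\ 'D_w (chart_map c \o hopf) z = xi].

(* The metric at [hopf z], for [z] in the sphere, evaluated at the tangent
   vectors with components [xi] and [eta] in the coordinates [c]: [s] times the
   metric for which the Hopf fibration is a Riemannian submersion. It does not
   depend on the choice of [z] in its fibre, as Sp(1) acts by isometries. *)
Definition HP_metric (s : R) (c : coord_system R HP (4 * q))
    (z : 'M[R]_(4, q.+1)) (xi eta : 'rV[R]_(4 * q)) : R :=
  s * dot (hlift c z xi) (hlift c z eta).

(* The coordinate vector field d/dx_i has components ['e_i] in [c]. *)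
Definition orthogonal_coordinates (s : R) (c : coord_system R HP (4 * q)) :
    Prop :=
  HP_coordinates c /\
  forall z, sphere z -> chart_dom c (hopf z) ->
  forall i j : 'I_(4 * q), i != j -> HP_metric s c z 'e_i 'e_j = 0.

End QuaternionicProjectiveSpace.

Arguments sphere R q : clear implicits.

(* Main.v *)
Require Import Defs.
From HB Require Import structures.
From mathcomp Require Import all_boot all_order all_algebra.
From mathcomp Require Import all_classical all_reals all_analysis.
From mathcomp Require Import ring lra zify.
Set Implicit Arguments.
Unset Strict Implicit.
Unset Printing Implicit Defensive.
Import Order.TTheory GRing.Theory Num.Theory.
Import numFieldNormedType.Exports.
Local Open Scope classical_set_scope.
Local Open Scope ring_scope.

(* Let x_1, ..., x_n (n = 4q) be orthogonal coordinates, pulled back along the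
   Hopf map to functions f_i on an open cone of H^(q+1).  Their gradients are
   pairwise orthogonal and orthogonal to the fibres.  At a unit point z put
   X_i = grad f_i, v_ij = (<X_i, X_j a>)_a in R^3 for the units a = i, j, k of H.
   Differentiating <grad f_i, grad f_j> = 0 once shows that Hess f_i (X_j) lies
   in the span of X_i, X_j and the fibre; differentiating it twice and using the
   symmetry of the third derivatives gives, for distinct i, j, k, l,
     v_ij . v_kl = v_ik . v_lj,
   which is the vanishing of the curvature components R_ijkl.
   For an orthonormal frame, summing this relation against v_kl over l turns it
   into an equation for each triangle i, j, k:
     v_ij - v_jk x v_ki = 2 (v_ij . v_ki) v_ki + (v_ij . v_jk) v_jk.
   Hence all |v_ij|^2 equal a common value rho in {0, 1, 1/3}; as the sum over j
   of |v_ij|^2 is 3, (n - 1) rho = 3, so n = 4 or n = 10 and q >= 2 fails. *)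

(** * Functions of class C^k *)

Section Ck_theory.
Variable R : realType.
Implicit Types V W : normedModType R.

Lemma open_near V (A : set V) x : open A -> A x -> \near x, A x.
Proof. by move=> oA Ax; exact: open_nbhs_nbhs. Qed.

(** The zero map is a differential, with a remainder that vanishes identically near [x]; through
    [near_eq_differentiable] this makes differentiability a local property. *)
Lemma near0_differentiable V W (f : V -> W) (x : V) :
  (\near x, f x = 0) -> differentiable f x.
Proof.
move=> f0; have c0 : continuous (\0 : V -> W) by move=> y; exact: cvg_cst.
have E : f \o shift x = cst (f x) + (\0 : {linear V -> W}) +o_ 0 id.
  have f0' : \forall h \near (0 : V), f (x + h) = 0 by move: f0 => /nbhs0P.
  apply/eqaddoP => _/posnumP[e]; near=> h; rewrite /=.
  rewrite !fctE /= (nbhs_singleton f0) !addr0 subr0.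
  by rewrite addrC (near f0' h) // normr0 mulr_ge0.
by apply/diff_locallyP; have dE := diff_unique c0 E; rewrite dE.
Unshelve. all: by end_near. Qed.

Lemma near_eq_differentiable V W (f g : V -> W) (x : V) :
  (\near x, f x = g x) -> differentiable f x -> differentiable g x.
Proof.
move=> fg df; have -> : g = f + (g - f) by rewrite addrC subrK.
apply: (differentiableD df).
apply: near0_differentiable; apply: filterS fg => y fg.
by rewrite !fctE fg subrr.
Qed.

Lemma eq_in_derive V W (A : set V) (f g : V -> W) (x v : V) :
  open A -> A x -> (forall y, A y -> f y = g y) -> 'D_v f x = 'D_v g x.
Proof.
move=> oA Ax fg; apply: near_eq_derive.
by apply: filterS (open_near oA Ax) => y; exact: fg.
Qed.

Lemma Ck_sub V W k (A B : set V) (f : V -> W) :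
  B `<=` A -> Ck k A f -> Ck k B f.
Proof.
move=> BA; elim: k f => [|k IH] f /=; first by move=> H x /BA; exact: H.
by case=> d H; split=> [x /BA|v]; [exact: d|exact: IH].
Qed.

Lemma Ck_pred V W k (A : set V) (f : V -> W) : Ck k.+1 A f -> Ck k A f.
Proof.
elim: k f => [|k IH] f [d H]; first by move=> x /d/differentiable_continuous.
by split=> // v; apply: IH.
Qed.

Lemma Ck_cst V W k (A : set V) (c : W) : Ck k A (cst c).
Proof.
elim: k c => [|k IH] c /=; first by move=> x _; exact: cvg_cst.
split=> [x _|v]; first exact: differentiable_cst.
suff -> : 'D_v (cst c) = cst 0 :> (V -> W) by exact: IH.
by apply/funext => x; rewrite derive_cst.
Qed.

Lemma Ck_eq V W k (A : set V) (f g : V -> W) :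
  open A -> (forall x, A x -> f x = g x) -> Ck k A f -> Ck k A g.
Proof.
move=> oA; elim: k f g => [|k IH] f g fg /=.
  move=> cf x Ax; rewrite /prop_for /continuous_at -fg //.
  apply: cvg_trans (cf x Ax); apply: near_eq_cvg.
  by apply: filterS (open_near oA Ax) => y /fg.
case=> df H; split=> [x Ax|v].
  apply: near_eq_differentiable (df x Ax).
  by apply: filterS (open_near oA Ax) => y /fg.
by apply: IH (H v) => x Ax; apply: eq_in_derive fg.
Qed.

Lemma CkD V W k (A : set V) (f g : V -> W) :
  open A -> Ck k A f -> Ck k A g -> Ck k A (fun x => f x + g x).
Proof.
move=> oA; elim: k f g => [|k IH] f g /=.
  by move=> cf cg x Ax; apply: cvgD; [exact: cf|exact: cg].
move=> [df Hf] [dg Hg]; split=> [x Ax|v].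
  by apply: differentiableD; [exact: df|exact: dg].
apply: Ck_eq (IH _ _ (Hf v) (Hg v)) => // x Ax.
by rewrite [RHS]deriveD //; apply: diff_derivable; [exact: df|exact: dg].
Qed.

Lemma Ck_sum V W k (A : set V) I (r : seq I) (f : I -> V -> W) :
  open A -> (forall i, Ck k A (f i)) -> Ck k A (fun x => \sum_(i <- r) f i x).
Proof.
move=> oA H; elim: r => [|i r IH].
  by under eq_fun do rewrite big_nil; exact: Ck_cst.
by under eq_fun do rewrite big_cons; exact: CkD.
Qed.

Lemma CkM V k (A : set V) (f g : V -> R) :
  open A -> Ck k A f -> Ck k A g -> Ck k A (fun x => f x * g x).
Proof.
move=> oA; elim: k f g => [|k IH] f g.
  by move=> cf cg x Ax; apply: cvgM; [exact: cf|exact: cg].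
move=> kf kg; have [df Hf] := kf; have [dg Hg] := kg; split=> [x Ax|v].
  by apply: differentiableM; [exact: df|exact: dg].
apply: Ck_eq (CkD oA (IH _ _ (Ck_pred kf) (Hg v)) (IH _ _ (Ck_pred kg) (Hf v))).
  by [].
move=> x Ax.
by rewrite [RHS]deriveM //; apply: diff_derivable; [exact: df|exact: dg].
Qed.

Lemma CkN V k (A : set V) (f : V -> R) :
  open A -> Ck k A f -> Ck k A (fun x => - f x).
Proof.
move=> oA kf; under eq_fun do rewrite -mulN1r.
exact: CkM (Ck_cst _ _ _) kf.
Qed.

Lemma CkV V k (A : set V) (f : V -> R) :
  open A -> (forall x, A x -> f x != 0) -> Ck k A f ->
  Ck k A (fun x => (f x)^-1).
Proof.
move=> oA f0; elim: k => [|k IH].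
  by move=> cf x Ax; apply: cvgV; [exact: f0|exact: cf].
move=> kf; have [df Hf] := kf; split=> [x Ax|v].
  by apply: differentiableV; [exact: df|exact: f0].
have kV := IH (Ck_pred kf).
apply: Ck_eq (CkN oA (CkM oA (CkM oA kV kV) (Hf v))) => // x Ax.
rewrite [RHS]deriveV; [|exact: f0|exact/diff_derivable/df].
by rewrite -mulNr -invfM expr2.
Qed.

Lemma Ck_linear V W k (A : set V) (f : {linear V -> W}) :
  continuous f -> Ck k A f.
Proof.
move=> cf; case: k => [|k]; first by move=> x _; exact: cf.
split=> [x _|v]; first exact: linear_differentiable.
have -> : 'D_v f = cst (f v); last exact: Ck_cst.
apply/funext => x; rewrite deriveE; last exact: linear_differentiable.
by rewrite diff_lin.
Qed.

Lemma Ck_coord m n k (A : set 'M[R]_(m, n)) i j :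
  Ck k A (fun x : 'M[R]_(m, n) => x i j : R).
Proof.
have @f : {linear 'M[R]_(m, n) -> R}.
  by exists (fun N : 'M[R]_(_, _) => N i j); do 2![eexists]; do ?[constructor];
     rewrite ?mxE// => ? *; rewrite ?mxE//; move=> ?; rewrite !mxE.
exact/(@Ck_linear _ _ k A f)/coord_continuous.
Qed.

Lemma differentiable_mx V m n (f : V -> 'M[R]_(m, n)) x :
  (forall i j, differentiable (fun x => f x i j : R) x) -> differentiable f x.
Proof.
move=> df.
have -> : f = \sum_(p < m) \sum_(r < n) (fun x => f x p r *: delta_mx p r).
  apply/funext => y; rewrite [LHS]matrix_sum_delta fct_sumE.
  by apply: eq_bigr => p _; rewrite fct_sumE.
by apply: differentiable_sum => p; apply: differentiable_sum => r;
  exact: differentiableZl.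
Qed.

Lemma continuous_fsum V W n (h : 'I_n -> V -> W) x :
  (forall i, {for x, continuous (h i)}) -> {for x, continuous (\sum_i h i)}.
Proof.
move=> ch; have c0 : {for x, continuous (0 : V -> W)} by exact: cvg_cst.
by elim/big_ind: _ => [//|g k cg ck|i _]; [exact: continuousD|exact: ch].
Qed.

Lemma continuous_mx V m n (f : V -> 'M[R]_(m, n)) (x : V) :
  (forall i j, {for x, continuous (fun x => f x i j : R)}) ->
  {for x, continuous f}.
Proof.
move=> cf.
have -> : f = \sum_(p < m) \sum_(r < n) (fun x => f x p r *: delta_mx p r).
  apply/funext => y; rewrite [LHS]matrix_sum_delta fct_sumE.
  by apply: eq_bigr => p _; rewrite fct_sumE.
apply: continuous_fsum => p; apply: continuous_fsum => r.
exact/continuousZr_tmp/cf.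
Qed.

Lemma derive_coord V m n (f : V -> 'M[R]_(m, n)) x v i j :
  differentiable f x -> ('D_v f x) i j = 'D_v (fun x => f x i j) x.
Proof. by move=> df; rewrite derive_mx ?mxE //; exact: diff_derivable. Qed.

Lemma derive_comp (U : normedModType R) V W (f : U -> V) (g : V -> W) x v :
  differentiable f x -> differentiable g (f x) ->
  'D_v (g \o f) x = 'D_('D_v f x) g (f x).
Proof.
move=> df dg; rewrite (deriveE _ (differentiable_comp df dg)) (deriveE _ df).
by rewrite (deriveE _ dg) (diff_comp df dg).
Qed.

Lemma derive_sum_delta m n W (g : 'M[R]_(m, n) -> W) y u :
  differentiable g y ->
  'D_u g y = \sum_i \sum_j u i j *: 'D_(delta_mx i j) g y.
Proof.
move=> dg; rewrite deriveE // {1}(matrix_sum_delta u) linear_sum.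
apply: eq_bigr => i _; rewrite linear_sum; apply: eq_bigr => j _.
by rewrite linearZ deriveE.
Qed.

(** Induction on [k] through the chain rule in coordinates: a directional derivative of [g \o f] is
    a sum of products of derivatives of the entries of [f] with partial derivatives of [g] composed
    with [f]. *)
Lemma Ck_comp V m n k (A : set V) (B : set 'M[R]_(m, n))
    (f : V -> 'M[R]_(m, n)) (g : 'M[R]_(m, n) -> R) :
  open A -> (forall x, A x -> B (f x)) ->
  (forall i j, Ck k A (fun x => f x i j : R)) -> Ck k B g -> Ck k A (g \o f).
Proof.
move=> oA AB; elim: k g => [|k IH] g kf.
  move=> cg x Ax; apply: continuous_comp (cg _ (AB _ Ax)).
  by apply: continuous_mx => i j; exact: kf.
move=> [dg Hg].
have df x : A x -> differentiable f x.
  by move=> Ax; apply: differentiable_mx => i j; exact: (kf i j).1.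
split=> [x Ax|v].
  by apply: differentiable_comp; [exact: df|exact/dg/AB].
have kp i j : Ck k A ('D_v (fun x => f x i j : R)) := (kf i j).2 v.
have IHg i j := IH _ (fun i j => Ck_pred (kf i j)) (Hg (delta_mx i j)).
apply: Ck_eq (Ck_sum _ oA (fun i => Ck_sum _ oA (fun j =>
  CkM oA (kp i j) (IHg i j)))) => // x Ax.
rewrite derive_comp; [|exact: df|exact/dg/AB].
rewrite derive_sum_delta; last exact/dg/AB.
apply: eq_bigr => i _; apply: eq_bigr => j _.
by rewrite derive_coord //; exact: df.
Qed.

Lemma Ck_entry V m n k (A : set V) (f : V -> 'M[R]_(m, n)) i j :
  open A -> Ck k A f -> Ck k A (fun x => f x i j : R).
Proof.
move=> oA; elim: k f => [|k IH] f.
  move=> cf x Ax.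
  exact: (@continuous_comp _ _ _ f (fun M : 'M[R]_(m, n) => M i j) x (cf x Ax)
    (@coord_continuous _ _ _ i j (f x))).
move=> [df Hf]; split=> [x Ax|v].
  exact: differentiable_comp (df x Ax) (differentiable_coord _ _ _).
apply: Ck_eq (IH _ (Hf v)) => // x Ax.
exact: (derive_coord _ _ _ (df x Ax)).
Qed.

Lemma line_diff V (y v : V) (a : R) :
  differentiable (fun b : R => y + b *: v) a /\
  'D_1 (fun b : R => y + b *: v) a = v.
Proof.
have dl : differentiable (fun b : R => y + b *: v) a.
  by apply: differentiableD => //; exact: differentiableZl.
split=> //; rewrite deriveD ?derive_cst ?add0r; last 2 first.
- exact: derivable_cst.
- by apply: diff_derivable; exact: differentiableZl.
rewrite deriveE; last exact: differentiableZl.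
by rewrite diff_val scale1r.
Qed.

Lemma derive_line V W (g : V -> W) (y v : V) (a : R) :
  differentiable g (y + a *: v) ->
  'D_1 (fun b : R => g (y + b *: v)) a = 'D_v g (y + a *: v).
Proof.
have [dl Dl] := line_diff y v a; move=> dg.
by rewrite [LHS](derive_comp _ dl dg) Dl.
Qed.

Lemma MVT_line V (g : V -> R) (y v : V) (t : R) : 0 < t ->
  (forall a, 0 <= a <= t -> differentiable g (y + a *: v)) ->
  exists2 a, 0 <= a <= t & g (y + t *: v) - g y = t * 'D_v g (y + a *: v).
Proof.
move=> t0 dg; pose l (a : R) := y + a *: v.
have dl a : differentiable l a by exact: (line_diff y v a).1.
have [] := @MVT_segment R (g \o l) (fun a => 'D_v g (l a)) 0 t (ltW t0).
- move=> a; rewrite in_itv /= => /andP[a0 at_].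
  have dga : differentiable g (l a) by apply: dg; rewrite !ltW.
  apply: DeriveDef; first exact/diff_derivable/differentiable_comp.
  exact: derive_line.
- apply: continuous_in_subspaceT => a; rewrite inE /= in_itv /= => a0t.
  exact/differentiable_continuous/(differentiable_comp (dl a))/dg.
move=> a; rewrite in_itv /= => a0t; rewrite subr0 /= /l scale0r addr0 => E.
by exists a => //; rewrite E mulrC.
Qed.

(** Mean value theorem twice: along [w] for the increment [g] of [f] in the direction [v], then
    along [v] for ['D_w f]. *)
Lemma second_difference V (A : set V) (f : V -> R) (x v w : V) (t : R) :
  0 < t -> Ck 2 A f ->
  (forall a b, 0 <= a <= t -> 0 <= b <= t -> A (x + a *: v + b *: w)) ->
  exists a b, [/\ 0 <= a <= t, 0 <= b <= t &
    f (x + t *: v + t *: w) - f (x + t *: v) - f (x + t *: w) + f x =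
    t * (t * 'D_v ('D_w f) (x + a *: v + b *: w))].
Proof.
move=> t0 [df Hf] At; have dwf := (Hf w).1.
have t01 : 0 <= t <= t by rewrite lexx ltW.
have t00 : 0 <= (0 : R) <= t by rewrite lexx ltW.
pose g y := f (y + t *: v) - f y.
have ds y : differentiable (shift (t *: v)) y by exact: differentiableD.
have dfs y : A (y + t *: v) -> differentiable (f \o shift (t *: v)) y.
  by move=> Ay; exact: differentiable_comp (ds y) (df _ Ay).
have A1 b : 0 <= b <= t -> A (x + b *: w + t *: v).
  by move=> b0; rewrite addrAC; exact: At.
have A0 b : 0 <= b <= t -> A (x + b *: w).
  by move=> b0; have := At 0 b t00 b0; rewrite scale0r addr0.
have [b bt gE] : exists2 b, 0 <= b <= t &
    g (x + t *: w) - g x = t * 'D_w g (x + b *: w).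
  apply: (@MVT_line _ g x w t t0) => b bt.
  exact: (differentiableB (dfs _ (A1 _ bt)) (df _ (A0 _ bt))).
have [a at_ fE] : exists2 a, 0 <= a <= t &
    'D_w f (x + b *: w + t *: v) - 'D_w f (x + b *: w) =
    t * 'D_v ('D_w f) (x + b *: w + a *: v).
  apply: (@MVT_line _ ('D_w f) (x + b *: w) v t t0) => a at_.
  by apply: dwf; rewrite addrAC; exact: At.
exists a, b; split; [exact: at_|exact: bt|]; rewrite [x + a *: v + _]addrAC -fE.
have -> : 'D_w f (x + b *: w + t *: v) - 'D_w f (x + b *: w) =
    'D_w g (x + b *: w).
  rewrite [RHS]deriveB; last 2 first.
  - exact/diff_derivable/dfs/A1.
  - exact/diff_derivable/df/A0.
  congr (_ - _); rewrite (derive_comp _ (ds _) (df _ (A1 _ bt))).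
  rewrite deriveD; [|exact: derivable_id|exact: derivable_cst].
  by rewrite derive_id derive_cst addr0.
by rewrite -gE /g [x + t *: w + _]addrAC; ring.
Qed.

(** The second difference over the parallelogram spanned by [t *: v] and [t *: w] is symmetric in
    [v] and [w]; by [second_difference] it is [t * t] times either mixed derivative at some point of
    the parallelogram, and continuity at [x] concludes. *)
Lemma schwarz V (A : set V) (f : V -> R) (x v w : V) :
  open A -> A x -> Ck 2 A f -> 'D_v ('D_w f) x = 'D_w ('D_v f) x.
Proof.
move=> oA Ax f2.
have cvw : {for x, continuous ('D_v ('D_w f))} by exact: ((f2.2 w).2 v).
have cwv : {for x, continuous ('D_w ('D_v f))} by exact: ((f2.2 v).2 w).
apply/eqP; rewrite -subr_eq0 -normr_le0; apply/ler_addgt0Pr => e e0.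
rewrite add0r.
have e20 : 0 < e / 2 by rewrite divr_gt0.
have := open_near oA Ax.
move/cvgrPdist_lt : cvw => /(_ _ e20) /[swap].
move/cvgrPdist_lt : cwv => /(_ _ e20) /[swap].
move=> HA /(filterI HA) {}HA /(filterI HA) {HA} /nbhs_normP[r /= r0 B].
(* With this [t] the whole parallelogram lies in the ball of radius [r]; the summand 1 keeps the
   denominator positive when [v] and [w] vanish. *)
pose t := r / (`|v| + `|w| + 1).
have n0 : 0 < `|v| + `|w| + 1 by rewrite ltr_wpDl // addr_ge0.
have t0 : 0 < t by rewrite divr_gt0.
have Bt a b : 0 <= a <= t -> 0 <= b <= t -> `|x - (x + a *: v + b *: w)| < r.
  move=> /andP[a0 at_] /andP[b0 bt].
  rewrite -addrA opprD addrA subrr add0r normrN.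
  apply: le_lt_trans (ler_normD _ _) _; rewrite !normrZ !ger0_norm //.
  apply: (@le_lt_trans _ _ (t * (`|v| + `|w|))).
    by rewrite mulrDr lerD // ler_wpM2r.
  by rewrite /t mulrAC ltr_pdivrMr // ltr_pM2l // ltrDl.
have [a [b [at_ bt E1]]] : exists a b, [/\ 0 <= a <= t, 0 <= b <= t &
    f (x + t *: v + t *: w) - f (x + t *: v) - f (x + t *: w) + f x =
    t * (t * 'D_v ('D_w f) (x + a *: v + b *: w))].
  apply: second_difference f2 _ => // a b a0 b0.
  by have [[]] := B _ (Bt a b a0 b0).
have [c [d [ct dt E2]]] : exists c d, [/\ 0 <= c <= t, 0 <= d <= t &
    f (x + t *: w + t *: v) - f (x + t *: w) - f (x + t *: v) + f x =
    t * (t * 'D_w ('D_v f) (x + c *: w + d *: v))].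
  apply: second_difference f2 _ => // c d c0 d0; rewrite addrAC.
  by have [[]] := B _ (Bt d c d0 c0).
have [[_ _] Hvw] := B _ (Bt a b at_ bt).
have := B _ (Bt d c dt ct).
rewrite [x + d *: v + _]addrAC => -[[_ Hwv] _].
rewrite /= in Hvw Hwv.
have E : t * (t * 'D_v ('D_w f) (x + a *: v + b *: w)) =
         t * (t * 'D_w ('D_v f) (x + c *: w + d *: v)).
  apply: etrans (esym E1) (etrans _ E2); rewrite [x + t *: w + _]addrAC.
  by congr (_ + _); exact: addrAC.
have tt : t != 0 by rewrite gt_eqF.
move: E Hvw Hwv => /(mulfI tt)/(mulfI tt) ->.
move: ('D_w ('D_v f) (x + c *: w + d *: v)) ('D_v ('D_w f) x) ('D_w ('D_v f) x).
move=> p p1 p2 Hvw Hwv; apply: le_trans (ler_distD p _ _) _.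
by rewrite [e]splitr lerD // ltW // distrC.
Qed.

End Ck_theory.

(** * Frames with vanishing curvature components *)

Section Frame_algebra.
Variable R : realFieldType.

Definition dot3 (a1 a2 a3 b1 b2 b3 : R) : R := a1 * b1 + a2 * b2 + a3 * b3.

(** With a, b, c standing for v_ij, v_jk, v_ki, the two systems are the triangle equations of (i, j,
    k) and (j, i, k). Their difference is zc = xb, so a minus the cross product of b and c is 3xb.
    Pairing this with a and with b gives the first and third claims; for x = 0 the last one is
    Lagrange's identity. *)
Lemma triple_norm (a1 a2 a3 b1 b2 b3 c1 c2 c3 : R) :
  let x := dot3 a1 a2 a3 b1 b2 b3 in
  let y := dot3 b1 b2 b3 c1 c2 c3 in
  let z := dot3 c1 c2 c3 a1 a2 a3 in
  [/\ a1 - (b2 * c3 - b3 * c2) = 2 * z * c1 + x * b1,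
      a2 - (b3 * c1 - b1 * c3) = 2 * z * c2 + x * b2 &
      a3 - (b1 * c2 - b2 * c1) = 2 * z * c3 + x * b3] ->
  [/\ a1 - (b2 * c3 - b3 * c2) = 2 * x * b1 + z * c1,
      a2 - (b3 * c1 - b1 * c3) = 2 * x * b2 + z * c2 &
      a3 - (b1 * c2 - b2 * c1) = 2 * x * b3 + z * c3] ->
  [/\ dot3 a1 a2 a3 a1 a2 a3 =
      a1 * (b2 * c3 - b3 * c2) + a2 * (b3 * c1 - b1 * c3) +
      a3 * (b1 * c2 - b2 * c1) + 3 * x ^+ 2,
      x ^+ 2 = z ^+ 2,
      x = 3 * (dot3 b1 b2 b3 b1 b2 b3) * x &
      x = 0 -> dot3 a1 a2 a3 a1 a2 a3 =
         dot3 b1 b2 b3 b1 b2 b3 * dot3 c1 c2 c3 c1 c2 c3 - y ^+ 2].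
Proof.
move=> x y z [p1 p2 p3] [r1 r2 r3].
have e1 : z * c1 = x * b1 by lra.
have e2 : z * c2 = x * b2 by lra.
have e3 : z * c3 = x * b3 by lra.
have xz : x ^+ 2 = z ^+ 2.
  have -> : x ^+ 2 = a1 * (x * b1) + a2 * (x * b2) + a3 * (x * b3).
    by rewrite /x /dot3; ring.
  by rewrite -e1 -e2 -e3 /z /dot3; ring.
split => //.
- have -> : x ^+ 2 = a1 * (x * b1) + a2 * (x * b2) + a3 * (x * b3).
    by rewrite /x /dot3; ring.
  have f1 : 3 * (x * b1) = a1 - (b2 * c3 - b3 * c2) by lra.
  have f2 : 3 * (x * b2) = a2 - (b3 * c1 - b1 * c3) by lra.
  have f3 : 3 * (x * b3) = a3 - (b1 * c2 - b2 * c1) by lra.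
  transitivity (a1 * (b2 * c3 - b3 * c2) + a2 * (b3 * c1 - b1 * c3) +
      a3 * (b1 * c2 - b2 * c1) + (a1 * (3 * (x * b1)) + a2 * (3 * (x * b2))
      + a3 * (3 * (x * b3)))); last by ring.
  by rewrite f1 f2 f3 /dot3; ring.
- have f1 : a1 = 3 * x * b1 + (b2 * c3 - b3 * c2) by lra.
  have f2 : a2 = 3 * x * b2 + (b3 * c1 - b1 * c3) by lra.
  have f3 : a3 = 3 * x * b3 + (b1 * c2 - b2 * c1) by lra.
  transitivity (a1 * b1 + a2 * b2 + a3 * b3); first by [].
  by rewrite {1}f1 {1}f2 {1}f3 /dot3; ring.
- move=> x0.
  have z0 : z = 0 by apply/eqP; rewrite -sqrf_eq0 -xz x0 expr0n.
  have f1 : a1 = b2 * c3 - b3 * c2.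
    by move: r1; rewrite x0 z0 mulr0 !mul0r addr0 => /subr0_eq.
  have f2 : a2 = b3 * c1 - b1 * c3.
    by move: r2; rewrite x0 z0 mulr0 !mul0r addr0 => /subr0_eq.
  have f3 : a3 = b1 * c2 - b2 * c1.
    by move: r3; rewrite x0 z0 mulr0 !mul0r addr0 => /subr0_eq.
  by rewrite /y /dot3 f1 f2 f3; ring.
Qed.

Variable n : nat.
Implicit Types v w u : 'I_n -> 'I_n -> R.

Definition dotv v w u (i j k l : 'I_n) : R :=
  dot3 (v i j) (w i j) (u i j) (v k l) (w k l) (u k l).

Lemma dotv_rot v w u i j k l : dotv w u v i j k l = dotv v w u i j k l.
Proof. by rewrite /dotv /dot3; ring. Qed.

(* The Gram relations satisfied by the matrices of right multiplication by the
   units i, j, k in an orthonormal basis of H^q. *)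
Definition quat_gram v w u :=
  [/\ forall k m, \sum_l v k l * v m l = (k == m)%:R,
      forall k m, \sum_l v k l * w m l = u k m &
      forall k m, v k m = - v m k].

Definition flat_frame v w u := forall i j k l,
  uniq [:: i; j; k; l] -> dotv v w u i j k l = dotv v w u i k l j.

Lemma triangle_coord v w u i j k :
  quat_gram v w u -> quat_gram w u v -> quat_gram u v w ->
  flat_frame v w u -> uniq [:: i; j; k] ->
  v i j - (w j k * u k i - u j k * w k i) =
  2 * dotv v w u k i i j * v k i + dotv v w u i j j k * v j k.
Proof.
move=> [vv vw va] [ww wu wa] [uu uv ua] F.
rewrite /= !inE negb_or andbT => /andP[/andP[ij ik] jk].
pose T l := dotv v w u i j k l - dotv v w u i k l j.
have va0 m : v m m = 0 by have := va m m; lra.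
have wa0 m : w m m = 0 by have := wa m m; lra.
have ua0 m : u m m = 0 by have := ua m m; lra.
(* The relation kills every [l] outside {i, j, k}, and [l = k] contributes nothing because
   [v k k = 0]. *)
have E1 : \sum_l T l * v k l = T i * v k i + T j * v k j.
  rewrite (bigD1 i) //= (bigD1 j) 1?eq_sym //= big1 ?addr0 // => l /andP[li lj].
  have [->|lk] := eqVneq l k; first by rewrite va0 mulr0.
  rewrite /T F ?subrr ?mul0r //= !inE !negb_or ij ik jk /=.
  by rewrite ![_ == l]eq_sym li lj lk.
(* Antisymmetry turns [v l j] into [- v j l], so that every sum runs over second indices and is a
   Gram entry. *)
have E2 : \sum_l T l * v k l =
   v i j * \sum_l v k l * v k l + w i j * \sum_l v k l * w k l
   + u i j * \sum_l u k l * v k l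
   + v i k * \sum_l v j l * v k l + w i k * \sum_l v k l * w j l
   + u i k * \sum_l u j l * v k l.
  rewrite !mulr_sumr -!big_split; apply: eq_bigr => l _ /=.
  by rewrite /T /dotv /dot3 (va l j) (wa l j) (ua l j); ring.
move: E2; rewrite E1 !vv !vw !uv eqxx (negbTE jk) ua0 wa0 /T.
rewrite /dotv /dot3 (va i k) (wa i k) (ua i k) (va k j) (wa k j) (ua k j).
rewrite va0 wa0 ua0 => E2.
move: E2; move: (v i j) (w i j) (u i j) (v j k) (w j k) (u j k)
  (v k i) (w k i) (u k i) => a1 a2 a3 b1 b2 b3 c1 c2 c3.
rewrite mulr1n mulr0n => E2; lra.
Qed.

(** The triangle equation of (j, i, k), rewritten by antisymmetry, is the second system of
    [triple_norm]. *)
Lemma triangle_norm v w u i j k :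
  quat_gram v w u -> quat_gram w u v -> quat_gram u v w ->
  flat_frame v w u -> uniq [:: i; j; k] ->
  [/\ dotv v w u i j i j =
      v i j * (w j k * u k i - u j k * w k i) +
      w i j * (u j k * v k i - v j k * u k i) +
      u i j * (v j k * w k i - w j k * v k i)
      + 3 * (dotv v w u i j j k) ^+ 2,
      (dotv v w u i j j k) ^+ 2 = (dotv v w u k i i j) ^+ 2,
      dotv v w u i j j k = 3 * (dotv v w u j k j k) * (dotv v w u i j j k) &
      dotv v w u i j j k = 0 -> dotv v w u i j i j =
        dotv v w u j k j k * dotv v w u k i k i - (dotv v w u j k k i) ^+ 2].
Proof.
move=> G1 G2 G3 F ijk.
have F2 : flat_frame w u v by move=> ? ? ? ? /F; rewrite -!(dotv_rot v w u).
have F3 : flat_frame u v w by move=> ? ? ? ? /F; rewrite !(dotv_rot u v w).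
have jik : uniq [:: j; i; k].
  by move: ijk; rewrite /= !inE !negb_or !andbT eq_sym andbAC.
have [v_as w_as u_as] : [/\ forall k m, v k m = - v m k,
    forall k m, w k m = - w m k & forall k m, u k m = - u m k].
  by case: G1 G2 G3 => _ _ ? [_ _ ?] [_ _ ?].
apply: triple_norm; split.
- exact: triangle_coord.
- by have := triangle_coord G2 G3 G1 F2 ijk; rewrite /dotv /dot3 => E; lra.
- by have := triangle_coord G3 G1 G2 F3 ijk; rewrite /dotv /dot3 => E; lra.
- have := triangle_coord G1 G2 G3 F jik.
  rewrite /dotv /dot3 (v_as j i) (w_as j i) (u_as j i) (v_as i k) (w_as i k).
  rewrite (u_as i k) (v_as k j) (w_as k j) (u_as k j) => E; lra.
- have := triangle_coord G2 G3 G1 F2 jik.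
  rewrite /dotv /dot3 (v_as j i) (w_as j i) (u_as j i) (v_as i k) (w_as i k).
  rewrite (u_as i k) (v_as k j) (w_as k j) (u_as k j) => E; lra.
- have := triangle_coord G3 G1 G2 F3 jik.
  rewrite /dotv /dot3 (v_as j i) (w_as j i) (u_as j i) (v_as i k) (w_as i k).
  rewrite (u_as i k) (v_as k j) (w_as k j) (u_as k j) => E; lra.
Qed.

(** The triple product is invariant under rotation of the triangle and the three squared inner
    products agree, so the three edges have one squared norm rho. A nonzero inner product forces 3
    rho = 1; otherwise rho equals its own square. *)
Lemma triangle_equilateral v w u i j k :
  quat_gram v w u -> quat_gram w u v -> quat_gram u v w ->
  flat_frame v w u -> uniq [:: i; j; k] ->
  dotv v w u k i k i = dotv v w u i j i j /\
  [\/ dotv v w u i j i j = 0, dotv v w u i j i j = 1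
    | dotv v w u i j i j = 3^-1].
Proof.
move=> G1 G2 G3 F ijk.
have jki : uniq [:: j; k; i] by rewrite -(rot_uniq 2).
have kij : uniq [:: k; i; j] by rewrite -(rot_uniq 1).
have [a1 a2 a3 a4] := triangle_norm G1 G2 G3 F ijk.
have [b1 b2 b3 b4] := triangle_norm G1 G2 G3 F jki.
have [c1 c2 c3 c4] := triangle_norm G1 G2 G3 F kij.
have ac : dotv v w u k i k i = dotv v w u i j i j.
  by rewrite a1 c1 a2; ring.
have ab : dotv v w u j k j k = dotv v w u i j i j.
  by rewrite a1 b1 -b2; ring.
split=> //; move: a3 a4; rewrite ab ac.
have [x0 _ /(_ x0)|x0 a3 _] := eqVneq (dotv v w u i j j k) 0.
  have -> : dotv v w u j k k i = 0.
    by apply/eqP; rewrite -sqrf_eq0 b2 x0 expr0n.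
  rewrite expr0n subr0 => E.
  have [->|r0] := eqVneq (dotv v w u i j i j) 0; first by constructor.
  by constructor 2; apply: (mulfI r0); rewrite mulr1 -E.
constructor 3; have : 1 = 3 * dotv v w u i j i j.
  by apply: (mulIf x0); rewrite mul1r.
by move=> E; lra.
Qed.

End Frame_algebra.

Lemma flat_frame_dim (R : realFieldType) n (v w u : 'I_n -> 'I_n -> R) :
  quat_gram v w u -> quat_gram w u v -> quat_gram u v w ->
  flat_frame v w u -> (2 < n)%N -> n = 4 \/ n = 10.
Proof.
case: n v w u => [|[|n]] // v w u G1 G2 G3 F n3.
have i1 : (1 < n.+2)%N by [].
pose o : 'I_n.+2 := Ordinal i1; pose rho := dotv v w u ord0 o ord0 o.
have R3 : [\/ rho = 0, rho = 1 | rho = 3^-1].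
  by apply: (triangle_equilateral G1 G2 G3 F (k := Ordinal n3) _).2.
have Rj j : j != ord0 -> dotv v w u ord0 j ord0 j = rho.
  move=> j0; have [->//|jo] := eqVneq j o.
  have /(triangle_equilateral G1 G2 G3 F)[+ _] : uniq [:: ord0; o; j].
    by rewrite /= !inE !negb_or ![_ == j]eq_sym j0 jo.
  rewrite -/rho => <-; case: G1 G2 G3 => _ _ va [_ _ wa] [_ _ ua].
  by rewrite /dotv /dot3 (va j) (wa j) (ua j); ring.
have : \sum_j dotv v w u ord0 j ord0 j = 3.
  case: G1 G2 G3 => vv _ _ [ww _ _] [uu _ _].
  by rewrite /dotv /dot3 !big_split /= vv ww uu eqxx mulr1n; ring.
have d0 : dotv v w u ord0 ord0 ord0 ord0 = 0.
  case: G1 G2 G3 => _ _ va [_ _ wa] [_ _ ua].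
  have := va ord0 ord0; have := wa ord0 ord0; have := ua ord0 ord0.
  by rewrite /dotv /dot3 => *; nra.
(* Among [n.+2] indices, [n.+1] copies of rho remain: their number is 3 for rho = 1 and 9 for rho =
   1/3. *)
rewrite (bigD1 ord0) //= d0 add0r (eq_bigr (fun=> rho)) // sumr_const.
rewrite cardC1 card_ord /= => H.
case: R3 H => -> H.
- by move: H; rewrite mul0rn => /esym/eqP; rewrite pnatr_eq0.
- by left; move: H => /eqP; rewrite eqr_nat => /eqP [->].
- right; have /eqP : (n.+1)%:R = 9 :> R.
    by move: H; rewrite -mulr_natr => H; lra.
  by rewrite eqr_nat => /eqP [->].
Qed.

(** * The inner product and the quaternionic structure *)

Section Dot_theory.
Variables (R : realType) (m : nat).
Implicit Types x y z : 'M[R]_(4, m).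

Lemma dotC x y : dot x y = dot y x.
Proof. by apply: eq_bigr => i _; apply: eq_bigr => j _; rewrite mulrC. Qed.

Lemma dotDl x y z : dot (x + y) z = dot x z + dot y z.
Proof.
rewrite /dot -big_split; apply: eq_bigr => i _; rewrite -big_split.
by apply: eq_bigr => j _; rewrite mxE mulrDl.
Qed.

Lemma dotZl a x z : dot (a *: x) z = a * dot x z.
Proof.
rewrite /dot mulr_sumr; apply: eq_bigr => i _; rewrite mulr_sumr.
by apply: eq_bigr => j _; rewrite mxE mulrA.
Qed.

Lemma dotDr x y z : dot z (x + y) = dot z x + dot z y.
Proof. by rewrite !(dotC z) dotDl. Qed.

Lemma dotZr a x z : dot z (a *: x) = a * dot z x.
Proof. by rewrite !(dotC z) dotZl. Qed.

Lemma dotNl x z : dot (- x) z = - dot x z.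
Proof. by rewrite -scaleN1r dotZl mulN1r. Qed.

Lemma dotNr x z : dot z (- x) = - dot z x.
Proof. by rewrite !(dotC z) dotNl. Qed.

Lemma dot0l z : dot 0 z = 0.
Proof. by rewrite -(scale0r z) dotZl mul0r. Qed.

Lemma dot0r z : dot z 0 = 0.
Proof. by rewrite dotC dot0l. Qed.

Lemma dot_sumr I (r : seq I) (f : I -> 'M[R]_(4, m)) z :
  dot z (\sum_(i <- r) f i) = \sum_(i <- r) dot z (f i).
Proof.
by elim/big_rec2: _ => [|i a b _ <-]; rewrite ?dot0r ?dotDr.
Qed.

Lemma dot_ge0 x : 0 <= dot x x.
Proof.
by apply: sumr_ge0 => i _; apply: sumr_ge0 => j _; rewrite -expr2 sqr_ge0.
Qed.

Lemma dot_eq0 x : (dot x x == 0) = (x == 0).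
Proof.
apply/eqP/eqP => [x0|->]; last exact: dot0l.
apply/matrixP => i j; rewrite mxE; apply/eqP; rewrite -sqrf_eq0 expr2.
have x1 k : 0 <= \sum_l x k l * x k l.
  by apply: sumr_ge0 => l _; rewrite -expr2 sqr_ge0.
move/eqP: x0; rewrite /dot psumr_eq0 // => /allP /(_ i (mem_index_enum _)).
rewrite psumr_eq0; last by move=> k _; rewrite -expr2 sqr_ge0.
by move=> /allP /(_ j (mem_index_enum _)).
Qed.

Lemma dot_gt0 x : x != 0 -> 0 < dot x x.
Proof. by move=> x0; rewrite lt_neqAle dot_ge0 eq_sym dot_eq0 x0. Qed.

Lemma dot_mxvec x y : dot x y = (mxvec x *m (mxvec y)^T) 0 0.
Proof.
rewrite mxE /dot pair_bigA (reindex (uncurry (@mxvec_index 4 m))) /=.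
  by apply: eq_bigr => -[i j] _ /=; rewrite mxE !mxvecE.
exact: curry_mxvec_bij.
Qed.

(** The rows of [P] are the vectors [b] and [D] holds their inverse squared norms, so orthogonality
    makes [P^T] a right inverse of [diag_mx D *m P]. The matrices are square, hence it is also a
    left inverse, and inserting that product between [x] and [y] gives the expansion. *)
Lemma parseval (I : finType) (b : I -> 'M[R]_(4, m)) x y :
  #|I| = (4 * m)%N -> (forall i j, i != j -> dot (b i) (b j) = 0) ->
  (forall i, b i != 0) ->
  dot x y = \sum_i dot x (b i) * dot y (b i) / dot (b i) (b i).
Proof.
move=> cI bij bi0.
pose e (k : 'I_(4 * m)) : I := enum_val (cast_ord (esym cI) k).
have e_bij : bijective e.
  apply: bij_comp; first exact: enum_val_bij.
  by exists (cast_ord cI) => k; rewrite ?cast_ordK ?cast_ordKV.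
pose P := \matrix_k mxvec (b (e k)).
pose D : 'rV[R]_(4 * m) := \row_k (dot (b (e k)) (b (e k)))^-1.
have PP : (diag_mx D *m P) *m P^T = 1%:M.
  apply/matrixP => k l; rewrite -mulmxA mul_diag_mx [LHS]mxE [in RHS]mxE.
  have -> : (P *m P^T) k l = dot (b (e k)) (b (e l)).
    by rewrite dot_mxvec !mxE; apply: eq_bigr => p _; rewrite !mxE.
  rewrite mxE; have [->|kl] := eqVneq k l.
    by rewrite mulVf // dot_eq0.
  have ekl : e k != e l by rewrite (bij_eq e_bij).
  by rewrite (bij _ _ ekl) mulr0.
rewrite dot_mxvec -[mxvec x]mulmx1 -(mulmx1C PP).
have PE z k : (mxvec z *m P^T) 0 k = dot z (b (e k)).
  by rewrite dot_mxvec !mxE; apply: eq_bigr => p _; rewrite !mxE.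
rewrite -!mulmxA mulmxA mxE (reindex e) /=; last exact: onW_bij.
apply: eq_bigr => k _; rewrite PE mul_diag_mx mxE.
have -> : (P *m (mxvec y)^T) k 0 = dot y (b (e k)).
  by rewrite -PE !mxE; apply: eq_bigr => p _; rewrite !mxE mulrC.
by rewrite !mxE; ring.
Qed.

End Dot_theory.

Section Quaternion_theory.
Variable R : realType.
Local Notation quat := 'cV[R]_4.
Implicit Types a b l : quat.

Definition qi : quat := quat_of [:: 0; 1; 0; 0].
Definition qj : quat := quat_of [:: 0; 0; 1; 0].
Definition qk : quat := quat_of [:: 0; 0; 0; 1].

Lemma qcD a b k : qc (a + b) k = qc a k + qc b k.
Proof. by rewrite /qc mxE. Qed.

Lemma qcN a k : qc (- a) k = - qc a k.
Proof. by rewrite /qc mxE. Qed.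

Ltac quat_ring := apply: qcP; case=> [|[|[|[|//]]]] _;
  rewrite ?(qcD, qcZ, qcN, qcE) //= ?(qcD, qcZ, qcN, qcE) //=; ring.

Lemma qmulDl a b l : qmul (a + b) l = qmul a l + qmul b l.
Proof. quat_ring. Qed.

Lemma qmulDr a b l : qmul l (a + b) = qmul l a + qmul l b.
Proof. quat_ring. Qed.

Lemma qmulZl x a l : qmul (x *: a) l = x *: qmul a l.
Proof. quat_ring. Qed.

Lemma qmulZr x a l : qmul l (x *: a) = x *: qmul l a.
Proof. quat_ring. Qed.

Lemma qconj_mul a : qmul (qconj a) a = dot a a *: qone R.
Proof.
apply: qcP; case=> [|[|[|[|//]]]] _;
  rewrite qcZ dotqE !qcE //= ?qcE //=; ring.
Qed.

Lemma dot_qmulr a b l : dot (qmul a l) b = dot a (qmul b (qconj l)).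
Proof. rewrite !dotqE !qcE //=; ring. Qed.

(** The products come in the order [qmul l' l] that [vq_gram] consumes: right multiplications
    compose in the opposite order. *)
Lemma qmul_units :
  [/\ qmul qj qi = - qk, qmul qk qj = - qi & qmul qi qk = - qj].
Proof. split; quat_ring. Qed.

Lemma qconj_units : [/\ qconj qi = - qi, qconj qj = - qj & qconj qk = - qk].
Proof. split; quat_ring. Qed.

Lemma dot_units : [/\ dot qi qi = 1, dot qj qj = 1 & dot qk qk = 1].
Proof. split; rewrite dotqE !qcE //=; ring. Qed.

Variable m : nat.
Implicit Types v w : 'M[R]_(4, m).

Lemma col_hscale v l j : col j (hscale v l) = qmul (col j v) l.
Proof. by apply/matrixP => i k; rewrite (ord1 k) !mxE. Qed.

Lemma eq_cols v w : (forall j, col j v = col j w) -> v = w.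
Proof.
by move=> vw; apply/matrixP => i j; have /colP/(_ i) := vw j; rewrite !mxE.
Qed.

Lemma colD v w j : col j (v + w) = col j v + col j w.
Proof. by apply/matrixP => i k; rewrite !mxE. Qed.

Lemma colZ x v j : col j (x *: v) = x *: col j v.
Proof. by apply/matrixP => i k; rewrite !mxE. Qed.

Lemma hscaleDl v w l : hscale (v + w) l = hscale v l + hscale w l.
Proof. by apply: eq_cols => j; rewrite colD !col_hscale colD qmulDl. Qed.

Lemma hscaleDr v l l' : hscale v (l + l') = hscale v l + hscale v l'.
Proof. by apply: eq_cols => j; rewrite colD !col_hscale qmulDr. Qed.

Lemma hscaleZl x v l : hscale (x *: v) l = x *: hscale v l.
Proof. by apply: eq_cols => j; rewrite colZ !col_hscale colZ qmulZl. Qed.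

Lemma hscaleZr x v l : hscale v (x *: l) = x *: hscale v l.
Proof. by apply: eq_cols => j; rewrite colZ !col_hscale qmulZr. Qed.

Lemma hscaleNr v l : hscale v (- l) = - hscale v l.
Proof. by rewrite -scaleN1r hscaleZr scaleN1r. Qed.

Lemma dot_cols v w : dot v w = \sum_j dot (col j v) (col j w).
Proof.
rewrite /dot exchange_big; apply: eq_bigr => j _; apply: eq_bigr => i _.
by rewrite big_ord1 !mxE.
Qed.

Lemma dot_hscalel v w l : dot (hscale v l) w = dot v (hscale w (qconj l)).
Proof.
by rewrite !dot_cols; apply: eq_bigr => j _; rewrite !col_hscale dot_qmulr.
Qed.

Lemma dot_hscale2 v w l l' :
  dot (hscale v l) (hscale w l') = dot v (hscale w (qmul l' (qconj l))).
Proof. by rewrite dot_hscalel hscaleA. Qed.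

Lemma dot_hscale_same v w l :
  dot (hscale v l) (hscale w l) = dot l l * dot v w.
Proof. by rewrite dot_hscale2 qmul_conj hscaleZr hscale1 dotZr. Qed.

End Quaternion_theory.

(** * Gradients *)

Section Linear_mx.
Variables (R : realType) (m n : nat) (W : normedModType R).
Variables (g : 'M[R]_(m, n) -> W).
Hypothesis lg : linear g.

(** A linear map on matrices is a finite sum of coordinates times fixed vectors, hence continuous,
    hence its own differential. *)
Lemma linear_mx_diff x : differentiable g x /\ forall v, 'D_v g x = g v.
Proof.
pose gM := GRing.isLinear.Build _ _ _ _ g lg.
pose h : {linear 'M[R]_(m, n) -> W} := HB.pack g gM.
have -> : g = h by [].
have hE : (h : 'M[R]_(m, n) -> W) = \sum_(i < m) \sum_(j < n)
    (fun y : 'M[R]_(m, n) => y i j *: g (delta_mx i j)).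
  apply/funext => y; rewrite {1}[y]matrix_sum_delta linear_sum fct_sumE.
  apply: eq_bigr => i _; rewrite linear_sum fct_sumE; apply: eq_bigr => j _.
  by rewrite linearZ.
have ch : continuous h.
  move=> y; rewrite hE.
  apply: continuous_fsum => p; apply: continuous_fsum => r.
  exact/continuousZr_tmp/coord_continuous.
split=> [|v]; first exact: linear_differentiable.
by rewrite deriveE; [rewrite diff_lin|exact: linear_differentiable].
Qed.

End Linear_mx.

Lemma derive_fsum (R : realType) (V W : normedModType R) n (h : 'I_n -> V -> W)
    (x v : V) :
  (forall i, derivable (h i) x v) ->
  'D_v (fun y => \sum_i h i y) x = \sum_i 'D_v (h i) x.
Proof.
move=> dh; rewrite -derive_sum //; congr (derive _ x v).
by apply/funext => y; rewrite fct_sumE.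
Qed.

Lemma derivable_fsum (R : realType) (V W : normedModType R) n
    (h : 'I_n -> V -> W) (x v : V) :
  (forall i, derivable (h i) x v) -> derivable (fun y => \sum_i h i y) x v.
Proof.
move=> dh; have -> : (fun y => \sum_i h i y) = \sum_i h i.
  by apply/funext => y; rewrite fct_sumE.
exact: derivable_sum.
Qed.

Section Gradient.
Variables (R : realType) (m : nat).
Local Notation E := 'M[R]_(4, m).
Implicit Types (f g : E -> R) (z u v w : E) (A : set E).

Definition grad f z : E := \matrix_(i, j) 'D_(delta_mx i j) f z.

Lemma dot_grad f z u : differentiable f z -> dot (grad f z) u = 'D_u f z :> R.
Proof.
move=> df; rewrite (derive_sum_delta _ df); apply: eq_bigr => i _.
by apply: eq_bigr => j _; rewrite mxE mulrC.
Qed.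

Lemma eq_in_grad A f g z : open A -> A z -> (forall y, A y -> f y = g y) ->
  grad f z = grad g z.
Proof.
move=> oA Az fg; apply/matrixP => i j; rewrite !mxE.
exact: (eq_in_derive _ oA Az).
Qed.

Lemma derivable_dot (a b : E -> E) z u : derivable a z u -> derivable b z u ->
  derivable (fun y => dot (a y) (b y) : R) z u.
Proof.
move=> /derivable_mxP da /derivable_mxP db.
apply: derivable_fsum => i; apply: derivable_fsum => j.
exact: (derivableM (da i j) (db i j)).
Qed.

Lemma derive_dot (a b : E -> E) z u : derivable a z u -> derivable b z u ->
  'D_u (fun y => dot (a y) (b y) : R) z =
  dot ('D_u a z) (b z) + dot (a z) ('D_u b z) :> R.
Proof.
move=> da' db'; have /derivable_mxP da := da'; have /derivable_mxP db := db'.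
have dab i j : derivable (fun y => a y i j * b y i j : R) z u.
  exact: (derivableM (da i j) (db i j)).
rewrite (derive_mx da') (derive_mx db').
rewrite /dot derive_fsum; last by move=> i; exact: derivable_fsum.
rewrite -big_split; apply: eq_bigr => i _; rewrite derive_fsum //=.
rewrite -big_split; apply: eq_bigr => j _ /=.
rewrite !mxE [LHS](deriveM (da i j) (db i j)) addrC; congr (_ + _).
exact: mulrC.
Qed.

Lemma derivable_grad A f z u : A z -> Ck 2 A f -> derivable (grad f) z u.
Proof.
move=> Az f2; apply/derivable_mxP => i j.
have -> : (fun y => grad f y i j) = 'D_(delta_mx i j) f.
  by apply/funext => y; rewrite mxE.
by apply: diff_derivable; exact: (f2.2 _).1.
Qed.

(** Schwarz's theorem. Thus [grad ('D_u f) z] is the Hessian of [f] applied to [u], in a form that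
    can be differentiated again. *)
Lemma derive_grad A f z u : open A -> A z -> Ck 2 A f ->
  'D_u (grad f) z = grad ('D_u f) z.
Proof.
move=> oA Az f2; rewrite (derive_mx (derivable_grad (u := u) Az f2)).
apply/matrixP => i j; rewrite !mxE.
rewrite -(schwarz _ _ oA Az f2); congr (derive _ z u).
by apply/funext => y; rewrite mxE.
Qed.

Lemma derive_dot_grad A f g z u : open A -> A z -> Ck 2 A f -> Ck 2 A g ->
  'D_u (fun y => dot (grad f y) (grad g y) : R) z =
  dot (grad ('D_u f) z) (grad g z) + dot (grad f z) (grad ('D_u g) z) :> R.
Proof.
move=> oA Az f2 g2.
have df := derivable_grad (u := u) Az f2.
have dg := derivable_grad (u := u) Az g2.
rewrite (derive_dot df dg).
by rewrite (derive_grad u oA Az f2) (derive_grad u oA Az g2).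
Qed.

Lemma derive2_dot_grad A f g z u v : open A -> A z -> Ck 3 A f -> Ck 3 A g ->
  'D_v ('D_u (fun y => dot (grad f y) (grad g y) : R)) z =
  dot (grad ('D_v ('D_u f)) z) (grad g z) +
  dot (grad ('D_u f) z) (grad ('D_v g) z) +
  (dot (grad ('D_v f) z) (grad ('D_u g) z) +
  dot (grad f z) (grad ('D_v ('D_u g)) z)) :> R.
Proof.
move=> oA Az f3 g3; have f2 := Ck_pred f3; have g2 := Ck_pred g3.
have fu := f3.2 u; have gu := g3.2 u.
have dg h : Ck 2 A h -> derivable (grad h) z v by exact: derivable_grad.
have d1 := derivable_dot (dg _ fu) (dg _ g2).
have d2 := derivable_dot (dg _ f2) (dg _ gu).
rewrite -(derive_dot_grad _ oA Az fu g2) -(derive_dot_grad _ oA Az f2 gu).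
rewrite -(deriveD d1 d2); apply: (eq_in_derive _ oA Az) => y Ay.
exact: (derive_dot_grad _ oA Ay f2 g2).
Qed.

Lemma linear_hscale (l : 'cV[R]_4) : linear (fun y : E => hscale y l).
Proof. by move=> a y w; rewrite hscaleDl hscaleZl. Qed.

Lemma derive_hscale_grad A f z u l : open A -> A z -> Ck 2 A f ->
  'D_u (fun y => dot (hscale y l) (grad f y) : R) z =
  dot (hscale u l) (grad f z) + dot (hscale z l) (grad ('D_u f) z) :> R.
Proof.
move=> oA Az f2; have [dh Dh] := linear_mx_diff (linear_hscale l) z.
have dh' := diff_derivable (v := u) dh.
have dg := derivable_grad (u := u) Az f2.
by rewrite (derive_dot dh' dg) Dh (derive_grad u oA Az f2).
Qed.

End Gradient.

(** * Right multiplication by quaternions in horizontal frames *)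

Section Quaternionic_frame.
Variables (R : realType) (q : nat).
Local Notation E := 'M[R]_(4, q.+1).
Implicit Types (z u w : E).

Definition hunit (a : 'I_4) : 'cV[R]_4 :=
  nth (qone R) [:: qone R; qi R; qj R; qk R] a.

Lemma dot_hunit a b : dot (hunit a) (hunit b) = (a == b)%:R.
Proof.
case: a => -[|[|[|[|//]]]] a4; case: b => -[|[|[|[|//]]]] b4;
  by rewrite dotqE /hunit /= !qcE //= ?mulr1n ?mulr0n; ring.
Qed.

(** In each column, left multiplication by a quaternion scales the inner product by its squared
    norm. For a unit [z] the vectors z, zi, zj, zk are thus an orthonormal basis of zH. *)
Lemma dot_hscale_left z l l' :
  dot (hscale z l) (hscale z l') = dot z z * dot l l'.
Proof.
rewrite dot_cols (dot_cols z z) mulr_suml; apply: eq_bigr => j _.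
by rewrite !col_hscale !dotqE !qcE //=; ring.
Qed.

(** The [4 * q] horizontal vectors together with z, zi, zj, zk form an orthogonal basis of H^(q+1),
    of real dimension 4q + 4. *)
Lemma horizontal_parseval z (x : 'I_(4 * q) -> E) u w :
  dot z z = 1 -> (forall i j, i != j -> dot (x i) (x j) = 0) ->
  (forall i, x i != 0) -> (forall i l, dot (x i) (hscale z l) = 0) ->
  dot u w = \sum_i dot u (x i) * dot w (x i) / dot (x i) (x i) +
    (dot u z * dot w z + dot u (hscale z (qi R)) * dot w (hscale z (qi R)) +
     dot u (hscale z (qj R)) * dot w (hscale z (qj R)) +
     dot u (hscale z (qk R)) * dot w (hscale z (qk R))).
Proof.
move=> z1 xx x0 xz.
pose b (i : 'I_(4 * q) + 'I_4) : E :=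
  match i with inl m => x m | inr a => hscale z (hunit a) end.
have bz a : dot (b (inr a)) (b (inr a)) = 1.
  by rewrite /b dot_hscale_left z1 dot_hunit eqxx mulr1.
rewrite (@parseval _ _ _ b u w).
- rewrite big_sumType /=; congr (_ + _).
  rewrite !big_ord_recr big_ord0 /= add0r.
  have e a : dot (hscale z (hunit a)) (hscale z (hunit a)) = 1 by exact: bz a.
  by rewrite !e !divr1 /hunit /= hscale1.
- by rewrite card_sum !card_ord mulnS addnC.
- case=> [i|a] [j|c] ij /=.
  + by apply: xx; apply: contra ij => /eqP ->.
  + exact: xz.
  + by rewrite dotC xz.
  + rewrite dot_hscale_left dot_hunit.
    by case: eqP => [ac|]; [rewrite ac eqxx in ij|rewrite mulr0].
- case=> [i|a]; first exact: x0.
  by rewrite -dot_eq0 bz oner_eq0.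
Qed.

Definition vq (x : 'I_(4 * q) -> E) (l : 'cV[R]_4) (i j : 'I_(4 * q)) : R :=
  dot (x i) (hscale (x j) l).

(* In an orthonormal basis of the orthogonal complement of z H the matrices of
   right multiplication by i, j, k satisfy the Gram relations. *)
Lemma vq_gram z (x : 'I_(4 * q) -> E) l l' l'' :
  dot z z = 1 -> (forall i j, dot (x i) (x j) = (i == j)%:R) ->
  (forall i l, dot (x i) (hscale z l) = 0) ->
  qconj l = - l -> qconj l' = - l' -> dot l l = 1 -> qmul l' l = - l'' ->
  quat_gram (vq x l) (vq x l') (vq x l'').
Proof.
move=> z1 xx xz lc l'c l1 ll.
have x0 i : x i != 0 by rewrite -dot_eq0 xx eqxx oner_eq0.
have xx0 i j : i != j -> dot (x i) (x j) = 0.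
  by move=> /negbTE ij; rewrite xx ij.
have anti a i j : qconj a = - a ->
    dot (x i) (hscale (x j) a) = - dot (hscale (x i) a) (x j).
  by move=> ac; rewrite dot_hscalel ac hscaleNr dotNr opprK.
(* zH is stable under right multiplication, so right multiples of [x i] stay orthogonal to it: only
   the horizontal terms of Parseval remain, and they form a matrix product. *)
have hz i a p : dot (hscale (x i) a) (hscale z p) = 0 by rewrite dot_hscale2.
have hz1 i a : dot (hscale (x i) a) z = 0 by rewrite -[z]hscale1 hz.
have G a b i j : qconj a = - a -> qconj b = - b ->
    \sum_m vq x a i m * vq x b j m = dot (hscale (x i) a) (hscale (x j) b).
  move=> ac bc; rewrite (horizontal_parseval _ _ z1 xx0 x0 xz) !hz !hz1.
  rewrite !mul0r !addr0; apply: eq_bigr => m _.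
  by rewrite /vq !anti // mulrNN xx eqxx divr1.
split=> [i j|i j|i j].
- by rewrite G // dot_hscale_same l1 mul1r xx.
- by rewrite G // dot_hscale2 lc -scaleN1r qmulZr ll hscaleZr hscaleNr
    scaleN1r opprK.
- by rewrite /vq anti // dotC.
Qed.

(** Normalizing the frame divides both sides of the relation by the same product of four lengths, so
    [flat_frame_dim] applies to the orthonormal frame [e]. *)
Lemma flat_horizontal_frame_dim z (x : 'I_(4 * q) -> E) :
  dot z z = 1 -> (forall i j, i != j -> dot (x i) (x j) = 0) ->
  (forall i, x i != 0) -> (forall i l, dot (x i) (hscale z l) = 0) ->
  flat_frame (vq x (qi R)) (vq x (qj R)) (vq x (qk R)) -> (2 <= q)%N -> False.
Proof.
move=> z1 xx x0 xz Fx q2; pose n i := Num.sqrt (dot (x i) (x i)).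
have n0 i : n i != 0 by rewrite gt_eqF // sqrtr_gt0 dot_gt0.
have nn i : dot (x i) (x i) = n i * n i.
  by rewrite -expr2 sqr_sqrtr // dot_ge0.
pose e i : E := (n i)^-1 *: x i.
have vE p i j : vq e p i j = (n i)^-1 * (n j)^-1 * vq x p i j.
  by rewrite /vq /e dotZl hscaleZl dotZr mulrA.
have ee i j : dot (e i) (e j) = (i == j)%:R.
  rewrite /e dotZl dotZr; have [->|ij] := eqVneq i j.
    by rewrite nn mulKf // mulVf.
  by rewrite xx // !mulr0.
have ez i p : dot (e i) (hscale z p) = 0 by rewrite /e dotZl xz mulr0.
have dE i j k l : dotv (vq e (qi R)) (vq e (qj R)) (vq e (qk R)) i j k l =
    (n i)^-1 * (n j)^-1 * (n k)^-1 * (n l)^-1 *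
    dotv (vq x (qi R)) (vq x (qj R)) (vq x (qk R)) i j k l.
  rewrite /dotv /dot3 !vE.
  by move: (n i)^-1 (n j)^-1 (n k)^-1 (n l)^-1 => *; ring.
have F : flat_frame (vq e (qi R)) (vq e (qj R)) (vq e (qk R)).
  move=> i j k l /Fx E0; rewrite !dE E0; congr (_ * _).
  by move: (n i)^-1 (n j)^-1 (n k)^-1 (n l)^-1 => *; ring.
have [ci cj ck] := qconj_units R; have [di dj dk] := dot_units R.
have [ji kj ik] := qmul_units R.
have q4 : (2 < 4 * q)%N by lia.
have := flat_frame_dim (vq_gram z1 ee ez ci cj di ji)
  (vq_gram z1 ee ez cj ck dj kj) (vq_gram z1 ee ez ck ci dk ik) F q4.
(* [4 * q = 4] contradicts [2 <= q], and 10 is not a multiple of 4. *)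
lia.
Qed.

End Quaternionic_frame.

(** * Functions with orthogonal gradients *)

(* Symmetry of the third derivatives leaves four unknowns [T] in six equations:
   the sum over the three splittings of {i, j, k, l} into pairs vanishes. *)
Lemma pairing_symmetric (R : realFieldType) (I : eqType)
    (T P : I -> I -> I -> I -> R) (i j k l : I) :
  (forall a b c d, T a b c d = T a c b d) ->
  (forall a b c d, T a b c d = T a b d c) ->
  (forall a b c d, P b a c d = - P a b c d) ->
  (forall a b c d, P a b c d = P c d a b) ->
  (forall a b c d, uniq [:: a; b; c; d] ->
    T a c d b + T b c d a = - (P a c b d + P a d b c)) ->
  uniq [:: i; j; k; l] -> P i j k l = P i k l j.
Proof.
move=> T12 T23 Pl Pr TP ijkl.
have p s : perm_eq s [:: i; j; k; l] -> uniq s by move=> /perm_uniq ->.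
have e2 : uniq [:: k; l; i; j] by apply: p; rewrite (perm_catC [:: k; l]).
have e3 : uniq [:: i; k; j; l].
  by apply: p; rewrite perm_cons (perm_catCA [:: k] [:: j] [:: l]).
have e4 : uniq [:: j; l; i; k] by rewrite (uniq_catC [:: j; l]).
have e5 : uniq [:: i; l; j; k].
  by apply: p; rewrite perm_cons (perm_catC [:: l]).
have e6 : uniq [:: j; k; i; l] by rewrite (uniq_catC [:: j; k]).
have := (TP _ _ _ _ ijkl, TP _ _ _ _ e2, TP _ _ _ _ e3).
have := (TP _ _ _ _ e4, TP _ _ _ _ e5, TP _ _ _ _ e6).
have P1 : P i k j l = - P i k l j by rewrite Pr Pl Pr.
have P2 : P k i l j = - P i k l j by rewrite Pl.
have P3 : P k j l i = P i l j k by rewrite Pl Pr Pl opprK.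
have P4 : P i l k j = - P i l j k by rewrite Pr Pl Pr.
have P5 : P j i l k = P i j k l by rewrite Pl Pr Pl opprK Pr.
have P6 : P j k l i = - P i l j k by rewrite Pr Pl.
have P7 : P i j l k = - P i j k l by rewrite Pr Pl Pr.
have P8 : P j i k l = - P i j k l by rewrite Pl.
have P9 : P j l k i = P i k l j by rewrite Pl Pr Pl opprK.
rewrite {}P1 {}P2 {}P3 {}P4 {}P5 {}P6 {}P7 {}P8 {}P9.
(* For each splitting into two pairs, the two equations add up to an expression of the same sum of
   four [T] as twice a difference of two of the three [P]. These three differences are equal and sum
   to 0, so they vanish. *)
rewrite (T23 i k l) (T12 i k) (T23 j k l) (T12 j k) (T23 i j l).
rewrite (T23 k j l) (T12 k j) (T23 l i k) (T23 l j k) (T12 l j) (T23 j i l).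
rewrite (T23 k i l) => -[[h4 h5] h6] [[h1 h2] h3]; lra.
Qed.

Section Orthogonal_gradients.
Variables (R : realType) (q : nat).
Local Notation E := 'M[R]_(4, q.+1).
Variables (W : set E) (f : 'I_(4 * q) -> E -> R) (z : E).
Hypotheses (oW : open W) (Wz : W z) (z1 : dot z z = 1).
Hypothesis f3 : forall i, Ck 3 W (f i).
Hypothesis orth : forall y i j, W y -> i != j ->
  dot (grad (f i) y) (grad (f j) y) = 0.
Hypothesis nz : forall i, grad (f i) z != 0.
Hypothesis vert : forall y i l, W y -> dot (hscale y l) (grad (f i) y) = 0.

Let x i : E := grad (f i) z.
(** [H i u] is the Hessian of [f i] at [z] applied to [u], and [D3 i u v w] is the third derivative
    of [f i] at [z] in the directions [u], [v], [w]. *)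
Let H i (u : E) : E := grad ('D_u (f i)) z.
Let D3 i (u v w : E) : R := dot (grad ('D_v ('D_u (f i))) z) w.

Let f2 i : Ck 2 W (f i). Proof. exact: Ck_pred. Qed.

Lemma hess_sym i u w : dot (H i u) w = dot (H i w) u.
Proof.
have d v : differentiable ('D_v (f i)) z by exact: ((f2 i).2 v).1.
apply: etrans (dot_grad w (d u)) (etrans _ (esym (dot_grad u (d w)))).
exact: (schwarz _ _ oW Wz (f2 i)).
Qed.

Lemma third_sym12 i u v w : D3 i u v w = D3 i v u w.
Proof.
have E : grad ('D_v ('D_u (f i))) z = grad ('D_u ('D_v (f i))) z.
  by apply: (eq_in_grad oW Wz) => y Wy; exact: (schwarz _ _ oW Wy (f2 i)).
exact: (congr1 (fun g => dot g w) E).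
Qed.

Lemma third_sym23 i u v w : D3 i u v w = D3 i u w v.
Proof.
have fu : Ck 2 W ('D_u (f i)) by exact: (f3 i).2.
have d t : differentiable ('D_t ('D_u (f i))) z by exact: (fu.2 t).1.
apply: etrans (dot_grad w (d v)) (etrans _ (esym (dot_grad v (d w)))).
exact: (schwarz _ _ oW Wz fu).
Qed.

(** Differentiating [vert] in the direction [u]; this brings the quaternionic structure into the
    Hessians. *)
Lemma hess_vert i u l : dot (H i u) (hscale z l) = - dot (x i) (hscale u l).
Proof.
have := derive_hscale_grad u l oW Wz (f2 i).
have -> : 'D_u (fun y => dot (hscale y l) (grad (f i) y) : R) z = 0 :> R.
  transitivity ('D_u (cst 0 : E -> R) z); last exact: derive_cst.
  by apply: (eq_in_derive _ oW Wz) => y Wy; exact: vert.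
rewrite ![dot (hscale _ _) _]dotC => /esym/eqP; rewrite addr_eq0 => /eqP ->.
by rewrite opprK.
Qed.

Lemma hess_swap i j u : i != j -> dot (H i u) (x j) = - dot (H j u) (x i).
Proof.
move=> ij; have := derive_dot_grad u oW Wz (f2 i) (f2 j).
have -> : 'D_u (fun y => dot (grad (f i) y) (grad (f j) y) : R) z = 0 :> R.
  transitivity ('D_u (cst 0 : E -> R) z); last exact: derive_cst.
  by apply: (eq_in_derive _ oW Wz) => y Wy; exact: orth.
by rewrite [X in _ + X]dotC => /esym/eqP; rewrite addr_eq0 => /eqP.
Qed.

(** [T a b c] is symmetric in its last two indices and skew in its outer two; alternating the two
    swaps three times returns to the start with sign -1. *)
Lemma hess_diag i j k : uniq [:: i; j; k] -> dot (H i (x j)) (x k) = 0.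
Proof.
pose T a b c := dot (H a (x b)) (x c).
have TS a b c : T a b c = T a c b by exact: hess_sym.
have TW a b c : a != c -> T a b c = - T c b a by exact: hess_swap.
rewrite -/(T i j k); clearbody T.
rewrite /= !inE negb_or andbT => /andP[/andP[ij ik] jk].
have := TW _ j _ ik; have := TW _ i _ jk; have := TW _ k _ ij.
by rewrite (TS k j i) (TS j k i) (TS i k j) => e1 e2 e3; lra.
Qed.

(** By [hess_diag] the horizontal part of the first factor lies in the span of [x i] and [x k], to
    which the second factor is orthogonal. The components along [z] vanish, so only those along zi,
    zj, zk remain, and [hess_vert] gives them. *)
Lemma hess_dot i j k l : uniq [:: i; j; k; l] ->
  dot (H i (x k)) (H j (x l)) =
  dotv (vq x (qi R)) (vq x (qj R)) (vq x (qk R)) i k j l.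
Proof.
move=> ijkl.
have xx a b : a != b -> dot (x a) (x b) = 0 by exact: orth.
have xz a p : dot (x a) (hscale z p) = 0 by rewrite dotC; exact: vert.
have [ij ik il] : [/\ i != j, i != k & i != l].
  by move: ijkl; rewrite /= !inE !negb_or => /and4P[/and3P[]].
have [jk jl kl] : [/\ j != k, j != l & k != l].
  by move: ijkl; rewrite /= !inE !negb_or andbT => /and3P[_ /andP[] ].
have Hz a b p : dot (H a (x b)) (hscale z p) = - vq x p a b by exact: hess_vert.
have H0 a b : a != b -> dot (H a (x b)) z = 0.
  by move=> ab; rewrite -[z]hscale1 Hz /vq hscale1 xx // oppr0.
have D a b c : uniq [:: a; b; c] -> dot (H a (x b)) (x c) = 0.
  exact: hess_diag.
have ui c : c != i -> c != k -> dot (H i (x k)) (x c) = 0.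
  by move=> ci ck; apply: D; rewrite /= !inE negb_or ik ![_ == c]eq_sym ci ck.
have wi : dot (H j (x l)) (x i) = 0.
  by apply: D; rewrite /= !inE negb_or jl [j == i]eq_sym ij eq_sym il.
have wk : dot (H j (x l)) (x k) = 0.
  by apply: D; rewrite /= !inE negb_or jl jk eq_sym kl.
move: (Hz i k) (Hz j l) (H0 i k ik) (H0 j l jl) ui wi wk.
move: (H i (x k)) (H j (x l)) => u w uz wz uz0 wz0 ui wi wk.
rewrite (horizontal_parseval _ _ z1 xx nz xz) big1.
  by rewrite uz0 wz0 !uz !wz /dotv /dot3 !mulrNN mul0r !add0r.
move=> c _; have [->|ci] := eqVneq c i; first by rewrite wi mulr0 mul0r.
have [->|ck] := eqVneq c k; first by rewrite wk mulr0 mul0r.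
by rewrite ui // !mul0r.
Qed.

(** Second derivative of <grad f_i, grad f_j> = 0 along [x k] and [x l]: two third derivatives and
    two products of Hessians, the latter evaluated by [hess_dot]. *)
Lemma third_sum i j k l : uniq [:: i; j; k; l] ->
  let P := dotv (vq x (qi R)) (vq x (qj R)) (vq x (qk R)) in
  D3 i (x k) (x l) (x j) + D3 j (x k) (x l) (x i) = - (P i k j l + P i l j k).
Proof.
move=> ijkl P.
have ij : i != j by move: ijkl; rewrite /= !inE !negb_or => /and4P[/and3P[]].
have ijlk : uniq [:: i; j; l; k].
  rewrite (perm_uniq (s2 := [:: i; j; k; l])) //.
  by rewrite !perm_cons (perm_catC [:: l]).
have sum4 (a b c d e p1 p2 : R) :
  a + b + (c + d) = 0 -> d = e -> b = p1 -> c = p2 -> a + e = - (p1 + p2).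
  by move=> h <- <- <-; lra.
have E0 : 'D_(x l) ('D_(x k) (fun y => dot (grad (f i) y) (grad (f j) y) : R)) z
    = 0 :> R.
  transitivity ('D_(x l) ('D_(x k) (cst 0 : E -> R)) z).
    apply: (eq_in_derive _ oW Wz) => y Wy.
    by apply: (eq_in_derive _ oW Wy) => t Wt; exact: orth.
  have -> : 'D_(x k) (cst 0 : E -> R) = cst 0.
    by apply/funext => y; rewrite derive_cst.
  exact: derive_cst.
have E1 := derive2_dot_grad (x k) (x l) oW Wz (f3 i) (f3 j).
exact: sum4 (etrans (esym E1) E0) (dotC _ _) (hess_dot ijkl) (hess_dot ijlk).
Qed.

Lemma vq_skew p i j : qconj p = - p -> vq x p i j = - vq x p j i.
Proof. by move=> pc; rewrite /vq dotC dot_hscalel pc hscaleNr dotNr. Qed.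

Lemma gradient_flat_frame :
  flat_frame (vq x (qi R)) (vq x (qj R)) (vq x (qk R)).
Proof.
have [qic qjc qkc] := qconj_units R.
have T12 := third_sym12; have T23 := third_sym23; have TP := third_sum.
have skew := vq_skew; clearbody D3 x.
move=> i j k l; apply: (@pairing_symmetric _ _
  (fun a b c d => D3 a (x b) (x c) (x d)) _ i j k l).
- by move=> a b c d; exact: T12.
- by move=> a b c d; exact: T23.
- move=> a b c d; rewrite /dotv /dot3 (skew _ b a qic) (skew _ b a qjc).
  by rewrite (skew _ b a qkc) !mulNr -!opprD.
- by move=> a b c d; rewrite /dotv /dot3; congr (_ + _ + _); exact: mulrC.
- exact: TP.
Qed.

Theorem orthogonal_gradients_dim : (2 <= q)%N -> False.
Proof.
have xx a b : a != b -> dot (x a) (x b) = 0 by exact: orth.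
have xz a p : dot (x a) (hscale z p) = 0 by rewrite dotC; exact: vert.
exact (flat_horizontal_frame_dim z1 xx nz xz gradient_flat_frame).
Qed.

End Orthogonal_gradients.

(** * The Hopf map in affine charts *)

Local Open Scope quotient_scope.

Section Hopf_fibration.
Variables (R : realType) (q : nat).
Local Notation E := 'M[R]_(4, q.+1).
Local Notation quat := 'cV[R]_4.
Local Notation HP := (HP R q).
Implicit Types (z w : E) (l : quat) (p : HP) (k : 'I_q.+1).

Lemma dot_normalize m (z : 'M[R]_(4, m)) : z != 0 ->
  dot ((Num.sqrt (dot z z))^-1 *: z) ((Num.sqrt (dot z z))^-1 *: z) = 1.
Proof.
move=> z0; rewrite dotZl dotZr mulrA -invfM -expr2 sqr_sqrtr ?dot_ge0 //.
by rewrite mulVf // dot_eq0.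
Qed.

Lemma val_normalize z : z != 0 ->
  \val (insubd (hopf_base R q) ((Num.sqrt (dot z z))^-1 *: z)) =
  (Num.sqrt (dot z z))^-1 *: z.
Proof.
by move=> z0; rewrite val_insubd ifT // inE; exact: dot_normalize.
Qed.

Lemma hscale_eq0 m (v : 'M[R]_(4, m)) l :
  l != 0 -> (hscale v l == 0) = (v == 0).
Proof.
by move=> l0; rewrite -dot_eq0 dot_hscale_same mulf_eq0 !dot_eq0 (negbTE l0).
Qed.

Lemma hopf_hscale z l : z != 0 -> l != 0 -> hopf (hscale z l) = hopf z.
Proof.
move=> z0 l0; have zl0 : hscale z l != 0 by rewrite hscale_eq0.
(* Normalization turns the factor [l] into the unit quaternion l / |l|, which acts along the
   fibre. *)
apply/esym/eqmodP/asboolP; exists ((Num.sqrt (dot l l))^-1 *: l).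
split; first exact: dot_normalize.
rewrite !val_normalize // hscaleZl hscaleZr scalerA -invfM dot_hscale_same.
by rewrite sqrtrM ?dot_ge0 // mulrC.
Qed.

Lemma hopf_val_repr p : hopf (\val (repr p)) = p.
Proof.
have v1 : dot (\val (repr p)) (\val (repr p)) = 1.
  by have := valP (repr p); rewrite inE.
rewrite /hopf v1 sqrtr1 invr1 scale1r -[RHS]reprK; congr (\pi _).
by apply: val_inj; rewrite val_insubd ifT // inE.
Qed.

Lemma val_repr_neq0 p : \val (repr p) != 0.
Proof.
have := valP (repr p); rewrite inE /sphere /= => v1.
by rewrite -dot_eq0 v1 oner_eq0.
Qed.

(** The point chosen by [repr] is not explicit, but it differs from [z] by a nonzero quaternion
    only, so functions invariant under [hscale] can be evaluated at [z] itself. *)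
Lemma repr_hopf z : z != 0 ->
  exists2 l, l != 0 & \val (repr (hopf z)) = hscale z l.
Proof.
move=> z0; have : repr (hopf z) = insubd (hopf_base R q)
    ((Num.sqrt (dot z z))^-1 *: z) %[mod HP] by rewrite reprK.
move=> /esym/eqmodP/asboolP[l [l1]]; rewrite val_normalize // => ->.
exists ((Num.sqrt (dot z z))^-1 *: l); last by rewrite hscaleZl hscaleZr.
rewrite scaler_eq0 invr_eq0 sqrtr_eq0 negb_or -ltNge dot_gt0 ?z0 //=.
by rewrite -dot_eq0 l1 oner_eq0.
Qed.

(** The formula of [affine_coord] at arbitrary homogeneous coordinates: free of the choice [repr],
    it can be differentiated in [z]. *)
Definition affine_of k z : 'rV[R]_(4 * q) :=
  mxvec (hscale (col' k z) (qinv (col k z))).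

Definition affine_lift k (y : 'rV[R]_(4 * q)) : E :=
  \matrix_(i, j) if unlift k j is Some j' then vec_mx y i j' else qone R i 0.

Lemma qmulV (a : quat) : a != 0 -> qmul a (qinv a) = qone R.
Proof.
by move=> a0; rewrite /qinv qmulZr qmul_conj scalerA mulVf ?scale1r // dot_eq0.
Qed.

Lemma qmul_eq0 (a l : quat) : l != 0 -> (qmul a l == 0) = (a == 0).
Proof.
by move=> l0; rewrite -dot_eq0 dot_qmul mulf_eq0 !dot_eq0 (negbTE l0) orbF.
Qed.

(** This cancellation makes affine coordinates independent of the homogeneous representative; at
    [a = 0] both sides are 0, as the inverse of 0 is 0. *)
Lemma qmul_qinv_qmul (a l : quat) : l != 0 -> qmul l (qinv (qmul a l)) = qinv a.
Proof.
move=> l0; rewrite /qinv qmulZr dot_qmul.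
have -> : qmul l (qconj (qmul a l)) = dot l l *: qconj a.
  by apply: qcP; case=> [|[|[|[|//]]]] _;
    rewrite qcZ dotqE !qcE //= ?qcE //=; ring.
by rewrite scalerA invfM -mulrA mulVf ?mulr1 // dot_eq0.
Qed.

Lemma col_col' k j z : col j (col' k z) = col (lift k j) z.
Proof. by apply/matrixP => a b; rewrite !mxE. Qed.

Lemma col'_hscale k z l : col' k (hscale z l) = hscale (col' k z) l.
Proof.
by apply: eq_cols => j; rewrite col_hscale !col_col' col_hscale.
Qed.

Lemma affine_of_hscale k z l : l != 0 ->
  affine_of k (hscale z l) = affine_of k z.
Proof.
move=> l0; rewrite /affine_of col'_hscale col_hscale hscaleA.
by rewrite qmul_qinv_qmul.
Qed.

Lemma col_neq0 k z : col k z != 0 -> z != 0.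
Proof.
apply: contra => /eqP ->; apply/eqP/matrixP => i j; by rewrite !mxE.
Qed.

Lemma affine_dom_hopf k z : z != 0 ->
  chart_dom (affine_chart R k) (hopf z) <-> col k z != 0.
Proof.
move=> z0; have [l l0 /= ->] := repr_hopf z0.
by rewrite col_hscale qmul_eq0.
Qed.

Lemma affine_coord_hopf k z : z != 0 -> affine_coord k (hopf z) = affine_of k z.
Proof.
move=> z0; have [l l0 E0] := repr_hopf z0.
by rewrite /affine_coord /= E0 -/(affine_of k _) affine_of_hscale.
Qed.

Lemma affine_lift_of k z : col k z != 0 ->
  affine_lift k (affine_of k z) = hscale z (qinv (col k z)).
Proof.
move=> zk; apply/matrixP => i j; rewrite [RHS]mxE mxE.
case: unliftP => [j' ->|->]; last by rewrite qmulV.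
by rewrite /affine_of mxvecK mxE col_col'.
Qed.

Lemma col_affine_lift k y : col k (affine_lift k y) = qone R.
Proof.
by apply/matrixP => i j; rewrite mxE [LHS]mxE unlift_none (ord1 j).
Qed.

Lemma qone_neq0 : qone R != 0.
Proof. by rewrite -dot_eq0 dot_qone oner_eq0. Qed.

Lemma affine_of_lift k y : affine_of k (affine_lift k y) = y.
Proof.
rewrite /affine_of col_affine_lift.
have -> : qinv (qone R) = qone R.
  rewrite /qinv dot_qone invr1 scale1r.
  by apply: qcP; case=> [|[|[|[|//]]]] _; rewrite !qcE //= ?qcE //= oppr0.
rewrite hscale1 -[RHS]vec_mxK; congr mxvec; apply/matrixP => i j.
by rewrite mxE [LHS]mxE liftK.
Qed.

Lemma qinv_neq0 (a : quat) : a != 0 -> qinv a != 0.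
Proof.
move=> a0; apply/eqP => a1; have := qone_neq0.
rewrite -(qmulV a0) a1.
have -> : qmul a 0 = 0 by rewrite -[X in qmul _ X](scale0r 0) qmulZr scale0r.
by rewrite eqxx.
Qed.

Lemma affine_param_of k z : col k z != 0 ->
  affine_param k (affine_of k z) = hopf z.
Proof.
move=> zk; rewrite /affine_param -/(affine_lift k _) affine_lift_of //.
by rewrite hopf_hscale ?qinv_neq0 //; exact: col_neq0 zk.
Qed.

End Hopf_fibration.

(** * Smoothness of the affine coordinates and openness of cones over open sets *)

Section Affine_smooth.
Variable R : realType.
Local Notation quat := 'cV[R]_4.

Lemma Ck_dot m k (A : set 'M[R]_(4, m)) : open A ->
  Ck k A (fun z : 'M[R]_(4, m) => dot z z : R).
Proof.
move=> oA; apply: (Ck_sum _ oA) => i; apply: (Ck_sum _ oA) => j.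
by apply: (CkM oA); exact: Ck_coord.
Qed.

Lemma continuous_dot m : continuous (fun z : 'M[R]_(4, m) => dot z z : R).
Proof. by move=> z; exact: (Ck_dot 0 openT). Qed.

Lemma open_neq0_preimage (T : topologicalType) (g : T -> R) :
  continuous g -> open [set x | g x != 0].
Proof.
move=> cg; have -> : [set x | g x != 0] = g @^-1` [set r | r != 0] by [].
by apply: open_comp => //; exact: open_neq.
Qed.

Lemma Ck_qmul (V : normedModType R) k (A : set V) (x y : V -> quat) : open A ->
  (forall n, (n < 4)%N -> Ck k A (fun v => qc (x v) n : R)) ->
  (forall n, (n < 4)%N -> Ck k A (fun v => qc (y v) n : R)) ->
  forall n, (n < 4)%N -> Ck k A (fun v => qc (qmul (x v) (y v)) n : R).
Proof.
move=> oA Cx Cy n n4.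
under eq_fun do rewrite qcE //.
have CM a b : (a < 4)%N -> (b < 4)%N ->
    Ck k A (fun v => qc (x v) a * qc (y v) b : R).
  by move=> a4 b4; apply: (CkM oA); [exact: Cx|exact: Cy].
case: n n4 => [|[|[|[|//]]]] _ /=;
  do 3![apply: (CkD oA); last by do ?[apply: (CkN oA)]; exact: CM]; exact: CM.
Qed.

Lemma Ck_qconj (V : normedModType R) k (A : set V) (x : V -> quat) : open A ->
  (forall n, (n < 4)%N -> Ck k A (fun v => qc (x v) n : R)) ->
  forall n, (n < 4)%N -> Ck k A (fun v => qc (qconj (x v)) n : R).
Proof.
move=> oA Cx n n4; under eq_fun do rewrite qcE //.
by case: n n4 => [|[|[|[|//]]]] _ /=; do ?[apply: (CkN oA)]; exact: Cx.
Qed.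

Variable q : nat.
Local Notation E := 'M[R]_(4, q.+1).

Lemma Ck_col n (A : set E) (k : 'I_q.+1) i j :
  Ck n A (fun z : E => col k z i j : R).
Proof.
have -> : (fun z : E => col k z i j : R) = (fun z => z i k).
  by apply/funext => z; rewrite mxE.
exact: Ck_coord.
Qed.

Lemma open_col_neq0 (k : 'I_q.+1) : open [set z : E | col k z != 0].
Proof.
have -> : [set z : E | col k z != 0] =
    [set z : E | dot (col k z) (col k z) != 0].
  by apply/seteqP; split => z /=; rewrite dot_eq0.
apply: open_neq0_preimage => z.
apply: (@continuous_comp _ _ _ (col k) (fun y => dot y y)).
  by apply: continuous_mx => i j; exact: (Ck_col 0 setT).
exact: continuous_dot.
Qed.

(** Every entry is a quadratic polynomial in [z] divided by the squared norm of the column [k],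
    which is nonzero on this set. *)
Lemma Ck_affine_of (k : 'I_q.+1) n i j :
  Ck n [set z : E | col k z != 0] (fun z => affine_of k z i j : R).
Proof.
have oA := @open_col_neq0 k.
rewrite (ord1 i); case/mxvec_indexP: j => a b.
have E0 : (fun z => affine_of k z 0 (mxvec_index a b)) =
   (fun z : E => (dot (col k z) (col k z))^-1 *
     qc (qmul (col (lift k b) z) (qconj (col k z))) a).
  apply/funext => z; rewrite /affine_of mxvecE mxE col_col' /qinv qmulZr mxE.
  by rewrite /qc inord_val.
rewrite E0; apply: (CkM oA).
  apply: (CkV oA); first by move=> z /=; rewrite dot_eq0.
  apply: (Ck_sum _ oA) => c; apply: (Ck_sum _ oA) => d.
  by apply: (CkM oA); exact: Ck_col.
apply: (Ck_qmul oA) => //; first by move=> m m4; exact: Ck_col.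
by apply: (Ck_qconj oA) => m m4; exact: Ck_col.
Qed.

(** Openness in the quotient means that the preimage in the sphere is the trace of an open set [B];
    normalization is continuous away from 0 and pulls [B] back to the cone. *)
Lemma open_hopf (U : set (HP R q)) : open U ->
  open [set z : E | z != 0 /\ U (hopf z)].
Proof.
move=> [B oB BU].
pose r (z : E) := (Num.sqrt (dot z z))^-1 *: z.
have -> : [set z : E | z != 0 /\ U (hopf z)] = [set z | z != 0 /\ B (r z)].
  have BUz z : z != 0 -> B (r z) = U (hopf z).
    move=> z0; rewrite -[U (hopf z)]/((\pi_(HP R q) @^-1` U) _) -BU /=.
    by rewrite -[r z](val_normalize z0).
  by apply/seteqP; split => z /= [z0]; rewrite BUz.
rewrite openE => z /= [z0 Bz]; rewrite /interior.
have dz : dot z z != 0 by rewrite dot_eq0.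
have cr : {for z, continuous r}.
  have r0 : Num.sqrt (dot z z) != 0 by rewrite sqrtr_eq0 -ltNge dot_gt0.
  have cs : {for z, continuous (fun y : E => Num.sqrt (dot y y))}.
    apply: (@continuous_comp _ _ _ (fun y : E => dot y y : R) Num.sqrt).
      exact: continuous_dot.
    exact: sqrt_continuous.
  have cv : {for z, continuous (fun y : E => (Num.sqrt (dot y y))^-1)}.
    exact: (cvgV r0 cs).
  have ci : {for z, continuous (@idfun E)} by move=> B0 H0; exact: H0.
  exact: (continuousZ cv ci).
have n0 : \forall y \near z, dot y y != 0.
  exact: (open_near (open_neq0_preimage (@continuous_dot q.+1)) dz).
have nB : \forall y \near z, B (r y) by exact: (cr _ (open_near oB Bz)).
by apply: filterS2 n0 nB => y; rewrite dot_eq0.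
Qed.

Lemma Ck_affine_lift (k : 'I_q.+1) n (A : set 'rV[R]_(4 * q)) i j :
  Ck n A (fun y => affine_lift k y i j : R).
Proof.
under eq_fun do rewrite mxE; case: (unlift k j) => [j'|]; last exact: Ck_cst.
by under eq_fun do rewrite mxE; exact: Ck_coord.
Qed.

Lemma continuous_affine_lift (k : 'I_q.+1) :
  continuous (affine_lift k : 'rV[R]_(4 * q) -> E).
Proof.
by move=> y; apply: continuous_mx => i j; exact: (Ck_affine_lift k 0 setT).
Qed.

End Affine_smooth.

(** * Orthogonal coordinates *)

Section Horizontal_lift.
Variables (R : realType) (q : nat).
Local Notation E := 'M[R]_(4, q.+1).
Local Notation quat := 'cV[R]_4.
Implicit Types (z w : E) (l : quat).

Lemma qmulVl (a : quat) : a != 0 -> qmul (qinv a) a = qone R.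
Proof.
by move=> a0; rewrite /qinv qmulZl qconj_mul scalerA mulVf ?scale1r // dot_eq0.
Qed.

Lemma hunit_expansion l : l = \sum_a dot l (hunit R a) *: hunit R a.
Proof.
rewrite !big_ord_recr big_ord0 /= add0r /hunit /=.
by apply: qcP; case=> [|[|[|[|//]]]] _; rewrite !qcD !qcZ !dotqE !qcE //=; ring.
Qed.

Lemma hscale_suml z I (r : seq I) (h : I -> quat) :
  hscale z (\sum_(i <- r) h i) = \sum_(i <- r) hscale z (h i).
Proof.
elim: r => [|i r IH]; last by rewrite !big_cons hscaleDr IH.
by rewrite !big_nil -(scale0r (0 : quat)) hscaleZr scale0r.
Qed.

Lemma vertical_projection z w : dot z z = 1 ->
  exists l, forall l', dot (hscale z l') (w - hscale z l) = 0.
Proof.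
(* For this [l], [hscale z l] is the orthogonal projection of [w] to zH, computed in the orthonormal
   basis of the [hscale z (hunit R a)]. *)
move=> z1; exists (\sum_a dot w (hscale z (hunit R a)) *: hunit R a) => l.
rewrite dotDr dotNr dot_hscale_left z1 mul1r dot_sumr {1}(hunit_expansion l).
rewrite hscale_suml dotC dot_sumr; apply/eqP; rewrite subr_eq0; apply/eqP.
by apply: eq_bigr => a _; rewrite hscaleZr !dotZr mulrC.
Qed.

(** The line z + h zl = z(1 + hl) stays in the cone over the fibre as long as 1 + hl is nonzero, so
    [g] is constant on it near h = 0. *)
Lemma derive_along_fibre (W : normedModType R) (g : E -> W) z l :
  (forall l', l' != 0 -> g (hscale z l') = g z) -> differentiable g z ->
  'D_(hscale z l) g z = 0.
Proof.
move=> gz dg; have z0 : z + 0 *: hscale z l = z by rewrite scale0r addr0.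
have dg0 : differentiable g (z + (0 : R) *: hscale z l) by rewrite z0.
have /esym := derive_line dg0; rewrite z0 => ->.
(* A nonzero real part already makes 1 + hl nonzero, and it is an open condition on [h]. *)
pose O := [set h : R | 1 + h * qc l 0 != 0].
have oO : open O.
  apply: open_neq0_preimage => h.
  have c1 : {for h, continuous (fun _ : R => 1 : R)} by exact: cvg_cst.
  have c2 : {for h, continuous (fun h : R => h * qc l 0)}.
    exact: mulrr_continuous.
  exact: (continuousD c1 c2).
have O0 : O 0 by rewrite /O /= mul0r addr0 oner_eq0.
transitivity ('D_1 (cst (g z) : R -> W) 0); last exact: derive_cst.
apply: (eq_in_derive _ oO O0) => h Oh.
have -> : z + h *: hscale z l = hscale z (qone R + h *: l).
  by rewrite hscaleDr hscale1 hscaleZr.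
apply: gz; apply: contra Oh => /eqP E0.
have := qcD (qone R) (h *: l) 0.
by rewrite E0 qcZ qcE //= /qc mxE => <-.
Qed.

(** Chain rule for the dilation by [a]; it carries relations between gradients from the unit sphere
    to the cone over it. *)
Lemma derive_homogeneous (g : E -> R) (W : set E) z (a : R) u : open W -> W z ->
  (forall y, W y -> g (a *: y) = g y) -> differentiable g (a *: z) ->
  'D_u g z = a * 'D_u g (a *: z).
Proof.
move=> oW Wz ga dg.
transitivity ('D_u (g \o ( *:%R a)) z).
  by apply: (eq_in_derive _ oW Wz) => y Wy; rewrite /= ga.
have la : linear ( *:%R a : E -> E).
  by move=> b y w; rewrite scalerDr !scalerA mulrC.
have [da Da] := linear_mx_diff la z.
by rewrite (derive_comp _ da dg) Da (deriveE _ dg) (deriveE _ dg) linearZ.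
Qed.

End Horizontal_lift.

(** * Coordinates pulled back to a cone in H^(q+1) *)

Section Coordinates.
Variables (R : realType) (q : nat) (c : coord_system R (HP R q) (4 * q)).
Variable k : 'I_q.+1.
Hypothesis cHP : HP_coordinates c.
Local Notation E := 'M[R]_(4, q.+1).
Implicit Types z w : E.

(** [W] is the cone over the part of the domain of [c] where the homogeneous coordinate [k] is
    nonzero, [F] is the pulled back coordinate map, and [B] is the image of that part in the affine
    chart. *)
Let W : set E := [set z | col k z != 0 /\ chart_dom c (hopf z)].
Let F : E -> 'rV[R]_(4 * q) := chart_map c \o hopf (q := q).
Let B : set 'rV[R]_(4 * q) :=
  affine_coord k @` (chart_dom c `&` chart_dom (affine_chart R k)).

Let W_neq0 z : W z -> z != 0. Proof. by case=> /col_neq0. Qed.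

Let openD : open (chart_dom c). Proof. by case: cHP => -[]. Qed.

Let mapK p : chart_dom c p -> chart_inv c (chart_map c p) = p.
Proof. by case: cHP => -[_ _ cK _ _] _ Dp; apply: cK; rewrite inE. Qed.

Lemma open_coordinates_dom : open W.
Proof.
have -> : W = [set z : E | col k z != 0] `&`
    [set z : E | z != 0 /\ chart_dom c (hopf z)].
  apply/seteqP; split => z /= [zk]; last by case.
  by move=> Dz; split=> //; split=> //; exact: col_neq0 zk.
by apply: openI; [exact: open_col_neq0|exact: open_hopf].
Qed.
Let oW := open_coordinates_dom.

Lemma affine_image z : W z -> B (affine_of k z).
Proof.
move=> Wz; have z0 := W_neq0 Wz; case: Wz => zk Dz.
exists (hopf z); first by split=> //; apply/affine_dom_hopf.
by rewrite affine_coord_hopf.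
Qed.

Lemma open_affine_image : open B.
Proof.
have -> : B = affine_lift k @^-1` [set z : E | z != 0 /\ chart_dom c (hopf z)].
  apply/seteqP; split => y /=.
    move=> [p [Dp pk] <-].
    have p0 := val_repr_neq0 p.
    have lE : affine_lift k (affine_coord k p) =
        hscale (\val (repr p)) (qinv (col k (\val (repr p)))).
      by rewrite -affine_lift_of.
    have i0 := qinv_neq0 pk.
    by rewrite lE hscale_eq0 // hopf_hscale // hopf_val_repr.
  move=> [y0 Dy]; exists (hopf (affine_lift k y)).
    split=> //; apply/affine_dom_hopf => //.
    by rewrite col_affine_lift qone_neq0.
  by rewrite affine_coord_hopf // affine_of_lift.
apply: open_comp; last exact: open_hopf.
by move=> y _; exact: continuous_affine_lift.
Qed.

Lemma coordinates_factor z : W z ->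
  F z = (chart_map c \o affine_param k) (affine_of k z).
Proof. by move=> [zk Dz]; rewrite /F /= affine_param_of. Qed.

(** On [W], [F] is the explicit smooth map [affine_of k] followed by the transition map from the
    affine chart to [c], smooth by compatibility. *)
Lemma Ck_coordinates n i : Ck n W (fun z => F z 0 i : R).
Proof.
have [_ /(_ _ (imageT (affine_chart R (q := q)) k)) [_ /= /(_ n) Cn]] := cHP.
have Ci := Ck_entry 0 i open_affine_image Cn.
have CG a b : Ck n W (fun z => affine_of k z a b : R).
  apply: (@Ck_sub _ _ _ n [set z : E | col k z != 0]); first by move=> z [].
  exact: Ck_affine_of.
apply: Ck_eq oW _ (Ck_comp oW affine_image CG Ci) => z Wz.
by rewrite /= coordinates_factor.
Qed.

Lemma differentiable_coordinates z : W z -> differentiable F z.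
Proof.
move=> Wz; apply: differentiable_mx => i j; rewrite (ord1 i).
exact: (Ck_coordinates 1 j).1.
Qed.

Lemma coordinates_hscale z l : z != 0 -> l != 0 -> F (hscale z l) = F z.
Proof. by move=> z0 l0; rewrite /F /= hopf_hscale. Qed.

(** A section [L] of [affine_of k] through [z] and the reverse transition map [G] satisfy
    [G \o F \o L = id] near [affine_of k z], so the differential of [F \o L], which is square, is
    invertible. *)
Lemma derive_coordinates_surj z xi : W z -> exists w, 'D_w F z = xi.
Proof.
move=> Wz; have [zk Dz] := Wz; have z0 := W_neq0 Wz.
pose L y : E := hscale (affine_lift k y) (col k z).
have L0 : L (affine_of k z) = z.
  by rewrite /L affine_lift_of // hscaleA qmulVl // hscale1.
have dL y : differentiable L y.
  apply: differentiable_mx => i j.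
  have C1 : Ck 1 setT
      (fun y => qc (qmul (col j (affine_lift k y)) (col k z)) i : R).
    apply: (Ck_qmul openT) => // n n4; last exact: Ck_cst.
    have -> : (fun y : 'rV[R]_(4 * q) => qc (col j (affine_lift k y)) n : R) =
        (fun y => affine_lift k y (inord n) j).
      by apply/funext => y'; rewrite /qc mxE.
    exact: Ck_affine_lift.
  have -> : (fun y => L y i j) =
      (fun y => qc (qmul (col j (affine_lift k y)) (col k z)) i).
    by apply/funext => y'; rewrite /L mxE /qc inord_val.
  exact: C1.1.
have dF := differentiable_coordinates Wz.
pose G := chart_map (affine_chart R k) \o chart_inv c.
have dG : differentiable G (F z).
  have [_ comp] := cHP.
  have [/= /(_ 1) [+ _] _] := comp _ (imageT (affine_chart R (q := q)) k).
  apply; exists (hopf z) => //; split=> //.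
  by apply/affine_dom_hopf.
have dFL : differentiable (F \o L) (affine_of k z).
  by apply: differentiable_comp; [exact: dL|rewrite L0].
have GFL u : 'D_('D_u (F \o L) (affine_of k z)) G (F z) = u.
  have E0 : (F \o L) (affine_of k z) = F z by rewrite /= L0.
  rewrite -E0 in dG *; rewrite -(derive_comp _ dFL dG).
  transitivity ('D_u (@idfun 'rV[R]_(4 * q)) (affine_of k z)).
    2: exact: derive_id.
  have oLW : open (L @^-1` W).
    apply: open_comp oW => y _; exact/differentiable_continuous.
  apply: (eq_in_derive _ oLW) => [|y]; first by rewrite /= L0.
  move=> Wy /=; have [yk Dy] := Wy.
  rewrite /G /F /= mapK // affine_coord_hopf; last exact: W_neq0.
  by rewrite /L affine_of_hscale // affine_of_lift.
have dGFL u : 'd G (F z) ('d (F \o L) (affine_of k z) u) = u.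
  have e1 : 'D_u (F \o L) (affine_of k z) = 'd (F \o L) (affine_of k z) u.
    exact: deriveE.
  have e2 v : 'D_v G (F z) = 'd G (F z) v by exact: deriveE.
  exact (etrans (esym (e2 _))
    (etrans (congr1 (fun v => 'D_v G (F z)) (esym e1)) (GFL u))).
(* Matrices act on row vectors, so [A *m C] is the differential of [F \o L] followed by that of [G];
   [mulmx1C] then gives [C *m A = 1], and [xi *m C] is the preimage of [xi]. *)
pose A := lin1_mx ('d (F \o L) (affine_of k z)).
pose C := lin1_mx ('d G (F z)).
have AC : A *m C = 1%:M.
  apply/row_matrixP => i; rewrite row1 rowE mulmxA !mul_rV_lin1.
  exact: dGFL.
exists ('D_(xi *m C) L (affine_of k z)).
have dF0 : differentiable F (L (affine_of k z)) by rewrite L0.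
have := derive_comp (xi *m C) (dL (affine_of k z)) dF0.
rewrite L0 => <-; apply: etrans (deriveE _ dFL) _.
rewrite -(mul_rV_lin1 ('d (F \o L) (affine_of k z))).
by rewrite -/A -mulmxA (mulmx1C AC) mulmx1.
Qed.

Lemma derive_coordinates_fibre z l : W z -> 'D_(hscale z l) F z = 0.
Proof.
move=> Wz; apply: derive_along_fibre; last exact: differentiable_coordinates.
by move=> l' l'0; exact: coordinates_hscale (W_neq0 Wz) l'0.
Qed.

(** The vertical part of a preimage of [xi] is invisible to [F] and can be removed, so the set
    defining [hlift] is inhabited and [xget] does not return its default 0. *)
Lemma hliftP z xi : W z -> dot z z = 1 ->
  (forall l, dot (hscale z l) (hlift c z xi) = 0) /\
  'D_(hlift c z xi) F z = xi.
Proof.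
move=> Wz z1; have [w Dw] := derive_coordinates_surj xi Wz.
have [l lw] := vertical_projection w z1.
have dF := differentiable_coordinates Wz.
have Dw' : 'D_(w - hscale z l) F z = xi.
  rewrite (deriveE _ dF) linearB -(deriveE _ dF) -(deriveE _ dF) Dw.
  by rewrite derive_coordinates_fibre // subr0.
have [[h1 h2] h3] : [set w | horizontal z w /\ 'D_w F z = xi] (hlift c z xi).
  apply: xgetPex; exists (w - hscale z l); split=> //; split=> [|l' _].
    by rewrite -[z in dot z]hscale1.
  exact: lw.
(* [horizontal] treats [z] and the imaginary multiples of [z] separately; splitting [l'] into real
   and imaginary parts covers all of zH. *)
split=> // l'; pose l0 := qc l' 0.
have -> : l' = l0 *: qone R + (l' - l0 *: qone R) by rewrite addrC subrK.
rewrite hscaleDr hscaleZr hscale1 dotDl dotZl h1 mulr0 add0r; apply: h2.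
by rewrite qcD qcN qcZ qcE //= mulr1 subrr.
Qed.

Variable s : R.
Hypothesis s0 : 0 < s.
Hypothesis ortho : forall z, sphere R q z -> chart_dom c (hopf z) ->
  forall i j : 'I_(4 * q), i != j -> HP_metric s c z 'e_i 'e_j = 0.

Let f i (z : E) : R := F z 0 i.

(** Among horizontal vectors the gradients are dual to the lifts [w] of the coordinate fields. The
    lifts are pairwise orthogonal because [s] is nonzero, and the dual of an orthogonal basis is
    orthogonal. *)
Lemma orthogonal_gradients_sphere z : W z -> dot z z = 1 ->
  (forall i j, i != j -> dot (grad (f i) z) (grad (f j) z) = 0) /\
  (forall i, grad (f i) z != 0).
Proof.
move=> Wz z1; pose w i := hlift c z 'e_i.
have dF := differentiable_coordinates Wz.
have df i : differentiable (f i) z by exact: (Ck_coordinates 1 i).1.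
have wP i := hliftP 'e_i Wz z1.
have fw i j : dot (grad (f i) z) (w j) = (j == i)%:R.
  apply: etrans (dot_grad (w j) (df i)) _.
  apply: etrans (esym (derive_coord (w j) 0 i dF)) _.
  by rewrite (wP j).2 mxE eqxx eq_sym.
have fv i l : dot (grad (f i) z) (hscale z l) = 0.
  apply: etrans (dot_grad _ (df i)) _.
  apply: etrans (esym (derive_coord _ 0 i dF)) _.
  by rewrite derive_coordinates_fibre // mxE.
have w0 i : w i != 0.
  by apply/eqP => wi; have := fw i i; rewrite wi dot0r eqxx => /esym/eqP;
    rewrite oner_eq0.
have ww i j : i != j -> dot (w i) (w j) = 0.
  move=> ij; have /eqP := ortho z1 Wz.2 ij.
  by rewrite /HP_metric mulf_eq0 gt_eqF //= => /eqP.
have wz i l : dot (w i) (hscale z l) = 0 by rewrite dotC; exact: (wP i).1.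
split=> [i j ij|i]; last first.
  apply/eqP => f0; have := fw i i; rewrite f0 dot0l eqxx => /esym/eqP.
  by rewrite oner_eq0.
move: fw fv; move: (fun i => grad (f i) z) => x fw fv.
rewrite (horizontal_parseval _ _ z1 ww w0 wz) !fv !mul0r !addr0 big1.
  by rewrite -[z in dot _ z]hscale1 fv mul0r add0r.
move=> m _; rewrite !fw; have [->|mi] := eqVneq m i.
  by rewrite (negbTE ij) mulr0 mul0r.
by rewrite !mul0r.
Qed.

(** The metric gives orthogonality at unit vectors only, while it must be differentiated on an open
    set. As [f i] is invariant under dilations, its gradient at [z] is a multiple of the one at the
    normalized point. *)
Lemma orthogonal_gradients z i j : W z -> i != j ->
  dot (grad (f i) z) (grad (f j) z) = 0.
Proof.
move=> Wz ij; have z0 := W_neq0 Wz.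
pose a := (Num.sqrt (dot z z))^-1.
have a0 : a != 0 by rewrite invr_eq0 sqrtr_eq0 -ltNge dot_gt0.
have aE y : a *: y = hscale y (a *: qone R) by rewrite hscaleZr hscale1.
have a1 : a *: qone R != 0 by rewrite scaler_eq0 negb_or a0 qone_neq0.
have Waz : W (a *: z).
  have [zk Dz] := Wz; rewrite aE; split; last by rewrite hopf_hscale.
  by rewrite col_hscale qmul_eq0.
have fa m y : W y -> f m (a *: y) = f m y.
  by move=> /W_neq0 y0; rewrite aE /f coordinates_hscale.
have df m y : W y -> differentiable (f m) y.
  by move=> Wy; exact: (Ck_coordinates 1 m).1.
have gE m : grad (f m) z = a *: grad (f m) (a *: z).
  apply/matrixP => p r; rewrite !mxE.
  exact: (derive_homogeneous _ oW Wz (fa m) (df m _ Waz)).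
rewrite !gE dotZl dotZr (orthogonal_gradients_sphere Waz _).1 ?mulr0 //.
exact: dot_normalize.
Qed.

Lemma orthogonal_coordinates_dim z : W z -> dot z z = 1 -> (2 <= q)%N -> False.
Proof.
move=> Wz z1; apply: (@orthogonal_gradients_dim _ _ W f z oW Wz z1).
- exact: Ck_coordinates.
- by move=> y i j Wy; exact: orthogonal_gradients.
- exact: (orthogonal_gradients_sphere Wz z1).2.
- move=> y i l Wy; rewrite dotC.
  have df : differentiable (f i) y by exact: (Ck_coordinates 1 i).1.
  apply: etrans (dot_grad _ df) _.
  apply: etrans (esym (derive_coord _ 0 i (differentiable_coordinates Wy))) _.
  by rewrite derive_coordinates_fibre // mxE.
Qed.

End Coordinates.

Theorem proposition4p1 (R : realType) (q : nat) (hq : (2 <= q)%N)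
    (s : R) (hs : 0 < s) :
  ~ exists c : coord_system R (HP R q) (4 * q),
      chart_dom c !=set0 /\ orthogonal_coordinates s c.
Proof.
move=> [c [[p Dp] [cHP ortho]]].
(* Some homogeneous coordinate of the representative is nonzero, so the point lies in an affine
   chart. *)
have [k zk] : exists k, col k (\val (repr p)) != 0.
  apply: contrapT => H; have /eqP := val_repr_neq0 p; apply.
  apply/eq_cols => j; have [->|j0] := eqVneq (col j (\val (repr p))) 0.
    by apply/matrixP => a b; rewrite !mxE.
  by case: H; exists j.
have z1 : dot (\val (repr p)) (\val (repr p)) = 1.
  by have := valP (repr p); rewrite inE.
apply: (orthogonal_coordinates_dim (k := k) cHP hs ortho _ z1 hq).
by split=> //; rewrite hopf_val_repr.
Qed.
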